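(* There is a universal constant $D_o$ such that the following holds. Assume (A1)--(A3), let $\mathcal{F}$ be a class of functions and $L$ a loss function as described in the context, with constants $M,B,L_M$. Then for every $n\ge1$, $\eta>0$ and $\varepsilon>0$, with probability not less than $1-\frac{11}{2}e^{-\eta}$, $$\frac{\hat H_\tau\hat G_\tau^2}{B}\left|R_L(f_n^C)-\inf_{f\in\mathcal{F}}R_L(f)\right|\le\frac{8\sqrt{2\eta+2\log\mathcal{N}(\mathcal{F},\|\cdot\|_\infty,\varepsilon)}+6D_o}{\sqrt n}+\frac{4\varepsilon L_M}{B}.$$
   Context: Let $\tau>0$ be a finite constant and $\mathcal{Z}\subset\mathbb{R}^d$. $T$ is a failure time, $Z$ is a random vector with values in $\mathcal{Z}$, $Y$ is a real-valued response, and $C\ge 0$ is a censoring time. Put $U=\min\{T,C\}$ and $\delta=\mathbf{1}\{T\le C\}$. The observed data are $(U_i,\delta_i,Z_i,Y_i)$, $i=1,\dots,n$, i.i.d. copies of $(U,\delta,Z,Y)$, with underlying $T_i,C_i$. $P$ denotes probability and also expectation. $S(t)=P(T>t)$, $G(t)=P(C>t)$, $H(t)=P(U>t)$; $g(t-)$ is the left limit of $g$ at $t$. Assumptions: (A1) $(T,Z,Y)$ is independent of $C$. (A2) $T$ takes values in $[0,\tau]$, and $H(\tau-)=P(U\ge\tau)>0$. (A3) $P(T=C)=0$. Kaplan--Meier estimator of $G$ (product over distinct observed times $s\le t$ among the $U_i$): $\hat G_n(t)=\prod_{s\le t}\left(1-\frac{\#\{i:U_i=s,\delta_i=0\}}{\#\{i:U_i\ge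 s\}}\right)$; $\hat G_\tau=\hat G_n(\tau-)$, $\hat H_\tau=\frac1n\sum_{i=1}^n\mathbf{1}\{U_i\ge\tau\}$. $\mathcal{F}$ is a class, compact in the sup norm $\|\cdot\|_\infty$, of integrable measurable functions $f:[0,\tau]\times\mathcal{Z}\to\mathbb{R}$ with $\|f\|_\infty\le M$ for all $f\in\mathcal{F}$, $M>0$. $L:\mathbb{R}\times\mathbb{R}\to[0,\infty)$ is a locally Lipschitz continuous loss such that, for constants $B$ and $L_M$: $L(y,f(t,z))\le B$ for all $(y,t,z)\in\mathbb{R}\times[0,\tau]\times\mathcal{Z}$ and $f\in\mathcal{F}$; and $\sup_y|L(y,s)-L(y,s')|\le L_M|s-s'|$ for all $s,s'\in[-M,M]$. $R_L(f)=P[L(Y,f(T,Z))]$. For $f\in\mathcal{F}$, $(L\circ f)(y,t,z)=L(y,f(t,z))$ and $\hat\mu_n(L\circ f)=\frac1n\sum_{i=1}^n\frac{\delta_iL(Y_i,f(T_i,Z_i))}{\hat G_n(T_i-)}$ (terms with $\delta_i=0$ are zero; when $\delta_i=1$, $T_i=U_i$). $f_n^C\in\operatorname{argmin}_{f\in\mathcal{F}}\hat\mu_n(L\circ f)$ is the empirical risk minimizer for right-censored data. $\mathcal{N}(\mathcal{F},\|\cdot\|_\infty,\varepsilon)$ is the size of the smallest covering of $\mathcal{F}$ by sup-norm balls of radius $\varepsilon$. ''Universal'' means not depending on $n,\eta,\varepsilon,\mathcal{F},L$, the constants $M,B,L_M$, or the distributions. In the paper $D_o$ is the constant in the Dvoretzky--Kiefer--Wolfowitz-type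 inequality for the Kaplan--Meier estimator (Bitouzé, Laurent, Massart 1999): $P(\sqrt n\,S(\tau-)\,\|\hat G_n-G\|_\infty\ge\varepsilon)\le\frac52e^{-2\varepsilon^2+D_o\varepsilon}$ for all $n\ge1$, $\varepsilon>0$ (supremum over $[0,\tau]$). *)

(* Defs.v *)
From HB Require Import structures.
From mathcomp Require Import all_boot all_order all_algebra.
From mathcomp Require Import all_classical all_reals all_analysis.

Set Implicit Arguments.
Unset Strict Implicit.
Unset Printing Implicit Defensive.

Import Order.TTheory GRing.Theory Num.Theory.
Import numFieldNormedType.Exports.

Local Open Scope classical_set_scope.
Local Open Scope ring_scope.

Definition left_lim (R : realType) (g : R -> R) (t : R) : R :=
  lim (g x @[x --> t^'-]).

Section independence.
Context (R : realType) (dO : measure_display) (Omega : measurableType dO).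
Context (P : probability Omega R).

Definition independent2 (d1 d2 : measure_display) (T1 : measurableType d1)
    (T2 : measurableType d2) (X1 : Omega -> T1) (X2 : Omega -> T2) : Prop :=
  forall (A1 : set T1) (A2 : set T2), measurable A1 -> measurable A2 ->
    P (X1 @^-1` A1 `&` X2 @^-1` A2) = (P (X1 @^-1` A1) * P (X2 @^-1` A2))%E.

Definition mutually_independent (I : finType) (d1 : measure_display)
    (T1 : measurableType d1) (X : I -> Omega -> T1) : Prop :=
  forall (J : {set I}) (A : I -> set T1),
    (forall i, i \in J -> measurable (A i)) ->
    P (\bigcap_(i in [set` J]) (X i @^-1` A i)) =
    (\prod_(i in J) P (X i @^-1` A i))%E.

Definition same_distribution (d1 : measure_display) (T1 : measurableType d1)
    (X1 X2 : Omega -> T1) : Prop :=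
  forall A : set T1, measurable A -> P (X1 @^-1` A) = P (X2 @^-1` A).

End independence.

(* [measurable_fun D f] holds vacuously when [D] is not measurable; this is
   measurability for the trace on [D] of the sigma-algebra, [D] arbitrary. *)
Definition measurable_on (d1 d2 : measure_display) (T1 : measurableType d1)
    (T2 : measurableType d2) (D : set T1) (f : T1 -> T2) : Prop :=
  forall B : set T2, measurable B ->
    strace (measurable : set_system T1) D (f @^-1` B `&` D).

Section sup_norm.
Context (R : realType) (X : choiceType) (D : set X).

(* A function on [D] is represented by a total function whose values outside
   [D] are irrelevant. *)
Definition sup_norm (f : X -> R) : \bar R :=
  ereal_sup [set `|f x|%:E | x in D].

(* The topology of {uniform` D -> R} is that of [sup_norm]. *)
Definition sup_norm_compact (F : set (X -> R)) : Prop :=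
  compact (F : set {uniform` D -> R}).

(* Closed balls with centers in [F]. *)
Definition ball_cover (F : set (X -> R)) (e : R) (m : nat) : Prop :=
  exists c : 'I_m -> X -> R, (forall j, F (c j)) /\
    forall f, F f -> exists j, (sup_norm (fun x => f x - c j x)%R <= e%:E)%E.

(* The default value 0 is used only if there is no finite covering, which is
   excluded for a compact [F] and [0 < e]. *)
Definition covering_number (F : set (X -> R)) (e : R) : nat :=
  xget 0%N [set m | ball_cover F e m /\
                    forall k, ball_cover F e k -> (m <= k)%N].

End sup_norm.

Section censoring.
Context (R : realType).

Section sample.
Context (n : nat) (u : 'I_n -> R) (delta : 'I_n -> bool).

Definition km_censoring (t : R) : R :=
  \prod_(s <- undup (codom u) | s <= t)
    (1 - #|[pred i | (u i == s) && ~~ delta i]|%:R /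
         #|[pred i | s <= u i]|%:R).

Definition emp_at_risk (t : R) : R := n%:R^-1 * \sum_(i < n) (t <= u i)%R%:R.

End sample.

Section observation.
Context (Omega V : Type).

Definition obs_time (T C : Omega -> R) (w : Omega) : R :=
  Num.min (T w) (C w).

Definition obs_status (T C : Omega -> R) (w : Omega) : bool := (T w <= C w)%R.

Definition observation (T C : Omega -> R) (Z : Omega -> V) (Y : Omega -> R)
    (w : Omega) : R * bool * V * R :=
  (obs_time T C w, obs_status T C w, Z w, Y w).

Context (n : nat) (T C : 'I_n -> Omega -> R).
Context (Z : 'I_n -> Omega -> V) (Y : 'I_n -> Omega -> R).

Definition Ghat (w : Omega) : R -> R :=
  km_censoring (fun i => obs_time (T i) (C i) w)
               (fun i => obs_status (T i) (C i) w).

Definition Hhat (tau : R) (w : Omega) : R :=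
  emp_at_risk (fun i => obs_time (T i) (C i) w) tau.

(* In the summands with delta_i = 0 the first factor is 0; in the others the
   denominator is nonzero. *)
Definition emp_risk (L : R -> R -> R) (f : R * V -> R) (w : Omega) : R :=
  n%:R^-1 * \sum_(i < n)
    ((obs_status (T i) (C i) w)%:R * L (Y i w) (f (T i w, Z i w)) /
     left_lim (Ghat w) (T i w)).

Definition is_erm (L : R -> R -> R) (F : set (R * V -> R))
    (fn : Omega -> R * V -> R) : Prop :=
  forall w, F (fn w) /\
            forall f, F f -> emp_risk L (fn w) w <= emp_risk L f w.

End observation.

(* Local Lipschitz continuity is required in the second argument only, for
   each fixed value of the first.  This, with joint measurability, follows
   both from local Lipschitz continuity on R x R and from measurability with
   the existence, for each [a], of a Lipschitz constant on [-a, a] that is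
   uniform in the first argument. *)
Definition loc_lipschitz_loss (L : R -> R -> R) : Prop :=
  [/\ forall y s, 0 <= L y s,
      measurable_fun setT (fun p : R * R => L p.1 p.2) &
      forall y, [locally [lipschitz (L y s) | s in setT]]].

Definition risk (dO : measure_display) (Omega : measurableType dO)
    (P : probability Omega R) (V : Type) (T : Omega -> R) (Z : Omega -> V)
    (Y : Omega -> R) (L : R -> R -> R) (f : R * V -> R) : R :=
  fine ('E_P[fun w => L (Y w) (f (T w, Z w))])%E.

End censoring.

(* Main.v *)
Require Import Defs.
From HB Require Import structures.
From mathcomp Require Import all_boot all_order all_algebra.
From mathcomp Require Import all_classical all_reals all_analysis.
From mathcomp Require Import measurable_realfun ring lra.

Set Implicit Arguments.
Unset Strict Implicit.
Unset Printing Implicit Defensive.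

Import Order.TTheory GRing.Theory Num.Theory.
Import numFieldNormedType.Exports.

Local Open Scope classical_set_scope.
Local Open Scope ring_scope.

(** Divide the loss by its bound [B], so that the observations carry marks in the
    unit interval, and fix one function of the class. The empirical risk is the
    sum of the marks of the failures, weighted by the inverse of the
    Kaplan--Meier estimator for the censoring times. When no failure is tied with
    a censoring and somebody is at risk at [tau], it equals the integral [V] of
    the marks against the Kaplan--Meier estimator for the failure times
    ([ipcw_sample]), for which a recursion over the sorted sample holds
    ([km_rec]): a censored observation leaves its mass to those on its right.

    Let [m] be the number of subjects at risk at [tau] and [c] the mean of the
    mark. The weight in the theorem makes [m * (V - c)] the quantity to be
    bounded ([km_dev]), and three facts do it.

    - Inserting an observation when [k] subjects are at risk changes [V] by
      [(y - V) / k] with [y] in the unit interval ([km_rec_insert]). Since [k > m],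
      exchanging one observation changes [m * (V - c)] by at most 2
      ([km_dev_bounded_diff]).

    - If mass that is left behind by a last observation censored at [u] is given
      the mean mark of failures after [u], then [V] is unbiased
      ([iid_mean_km_int]). This follows by induction from self-consistency
      ([km_int_self]). In [m * (V - c)], a sum over the subjects at risk at [tau],
      leave the subject in question out of [V]: this changes the sum by at most 1
      and makes its mean vanish, so that the mean of [m * (V - c)] is between -1
      and 1 ([iid_mean_km_dev]).

    - By the bounded difference inequality ([iid_mean_tail]), obtained from
      exponential moments by integrating one observation at a time, the
      probability of [|m * (V - c)| >= 1 + t] is at most
      [2 * exp (4 * n * l^2 - l * t)] for all small [l] ([km_dev_tail]).

    With [x = eta + log N] and [t = 4 * sqrt (2 * n * x)] the exceptional events of
    the [N] centers of a cover have total probability at most [2 * exp (- eta)].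
    Passing from a function to the nearest center costs [LM * eps] in the risk and,
    as the weights add up to at most 1, in the empirical risk. Comparing the
    empirical minimizer with any other function doubles the error, which gives
    the bound with the constant [Do = 1]. *)

(** * Expectations of bounded functions *)

Section bounded_measurable.
Context (R : realType) (d : measure_display) (T : measurableType d).

(** A class of integrands closed under the operations that occur below, on which
    integrals of real functions need no integrability side conditions. *)
Definition bmeasurable (g : T -> R) :=
  measurable_fun setT g /\ exists b : R, forall x, `|g x| <= b.

Lemma bmeasurable_cst c : bmeasurable (fun=> c).
Proof. by split; [exact: measurable_cst|exists `|c|]. Qed.

Lemma bmeasurableD f g : bmeasurable f -> bmeasurable g ->
  bmeasurable (fun x => f x + g x).
Proof.
move=> [mf [b hb]] [mg [c hc]]; split; first exact: measurable_funD.
by exists (b + c) => x; rewrite (le_trans (ler_normD _ _))// lerD.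
Qed.

Lemma bmeasurableM f g : bmeasurable f -> bmeasurable g ->
  bmeasurable (fun x => f x * g x).
Proof.
move=> [mf [b hb]] [mg [c hc]]; split; first exact: measurable_funM.
by exists (b * c) => x; rewrite normrM ler_pM.
Qed.

Lemma bmeasurableN f : bmeasurable f -> bmeasurable (fun x => - f x).
Proof.
move=> bf; rewrite (_ : (fun _ => _) = (fun x => -1 * f x)).
  by apply: bmeasurableM => //; exact: bmeasurable_cst.
by apply/funext => x; rewrite mulN1r.
Qed.

Lemma bmeasurableB f g : bmeasurable f -> bmeasurable g ->
  bmeasurable (fun x => f x - g x).
Proof. by move=> bf bg; apply: bmeasurableD => //; exact: bmeasurableN. Qed.

Lemma bmeasurable_bool (b : T -> bool) :
  measurable_fun setT b -> bmeasurable (fun x => (b x)%:R).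
Proof.
move=> mb; split.
  rewrite (_ : (fun _ => _) = (fun x => if b x then 1 else 0)).
    by apply: measurable_fun_ifT => //; exact: measurable_cst.
  by apply/funext => x; case: (b x).
by exists 1 => x; case: (b x); rewrite ?normr1 ?normr0 ?lexx ?ler01.
Qed.

Variable P : probability T R.

Lemma bmeasurable_integrable g : bmeasurable g ->
  P.-integrable setT (EFin \o g).
Proof.
move=> [mg [b hb]]; apply: measurable_bounded_integrable => //.
  by rewrite ltey_eq fin_num_measure.
exists b; split; first exact: num_real.
by move=> M bM x _ /=; apply: (le_trans (hb x)); exact: ltW.
Qed.

Lemma Ex_cst c : \int[P]_x (fun=> c) x = c.
Proof. by rewrite Rintegral_cst//= probability_setT/= mulr1. Qed.

Lemma Ex_eq f g : f =1 g -> \int[P]_x f x = \int[P]_x g x.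
Proof. by move=> fg; apply: eq_Rintegral => x _; exact: fg. Qed.

Lemma ExD f g : bmeasurable f -> bmeasurable g ->
  \int[P]_x (f x + g x) = \int[P]_x f x + \int[P]_x g x.
Proof. by move=> bf bg; apply: RintegralD => //; exact: bmeasurable_integrable. Qed.

Lemma ExB f g : bmeasurable f -> bmeasurable g ->
  \int[P]_x (f x - g x) = \int[P]_x f x - \int[P]_x g x.
Proof. by move=> bf bg; apply: RintegralB => //; exact: bmeasurable_integrable. Qed.

Lemma ExZl c f : bmeasurable f -> \int[P]_x (c * f x) = c * \int[P]_x f x.
Proof. by move=> bf; apply: RintegralZl => //; exact: bmeasurable_integrable. Qed.

Lemma ExZr c f : bmeasurable f -> \int[P]_x (f x * c) = (\int[P]_x f x) * c.
Proof. by move=> bf; apply: RintegralZr => //; exact: bmeasurable_integrable. Qed.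

Lemma le_Ex f g : bmeasurable f -> bmeasurable g -> (forall x, f x <= g x) ->
  \int[P]_x f x <= \int[P]_x g x.
Proof. by move=> bf bg fg; apply: le_Rintegral => //; exact: bmeasurable_integrable. Qed.

Lemma Ex_le_cst f c : bmeasurable f -> (forall x, f x <= c)
  -> \int[P]_x f x <= c.
Proof. by move=> bf fc; rewrite -[leRHS]Ex_cst; apply: le_Ex => //; exact: bmeasurable_cst. Qed.

Lemma Ex_ge_cst f c : bmeasurable f -> (forall x, c <= f x)
  -> c <= \int[P]_x f x.
Proof. by move=> bf fc; rewrite -[leLHS]Ex_cst; apply: le_Ex => //; exact: bmeasurable_cst. Qed.

Lemma Ex_norm_le f c : bmeasurable f -> (forall x, `|f x| <= c)
  -> `|\int[P]_x f x| <= c.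
Proof.
move=> bf fc; rewrite ler_norml Ex_ge_cst//=.
  by apply: Ex_le_cst => // x; rewrite (le_trans (ler_norm _)).
by move=> x; have := fc x; rewrite ler_norml => /andP[].
Qed.

Lemma Ex_indic (b : T -> bool) : measurable_fun setT b ->
  (\int[P]_x (b x)%:R)%:E = P [set x | b x].
Proof.
move=> mb; have mA : measurable [set x | b x].
  by have := mb measurableT [set true] I; rewrite setTI.
rewrite /Rintegral fineK; last first.
  by apply: integrable_fin_num => //; apply: bmeasurable_integrable; exact: bmeasurable_bool.
under eq_integral => x _.
  rewrite (_ : (b x)%:R = \1_[set x | b x] x); first over.
  by rewrite indicE; congr ((nat_of_bool _)%:R); apply/idP/idP => [h|/set_mem//]; exact: mem_set.
by rewrite integral_indic// setIT.
Qed.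

End bounded_measurable.

Section fubini.
Context (R : realType) (d1 d2 : measure_display).
Context (T1 : measurableType d1) (T2 : measurableType d2).

Lemma bmeasurable_comp (f : T2 -> R) (g : T1 -> T2) :
  measurable_fun setT g -> bmeasurable f -> bmeasurable (f \o g).
Proof.
move=> mg [mf [b hb]]; split; first exact: measurableT_comp.
by exists b => x; exact: hb.
Qed.

Lemma bmeasurable_pair1 x (F : T1 * T2 -> R) : bmeasurable F ->
  bmeasurable (fun y => F (x, y)).
Proof.
move=> [mF [b hb]]; split; first exact: measurable_fun_pair2.
by exists b => y; exact: hb.
Qed.

Lemma bmeasurable_pair2 y (F : T1 * T2 -> R) : bmeasurable F ->
  bmeasurable (fun x => F (x, y)).
Proof.
move=> [mF [b hb]]; split; first exact: measurable_fun_pair1.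
by exists b => x; exact: hb.
Qed.

Lemma bmeasurable_Ex (P : probability T2 R) (F : T1 * T2 -> R)
  : bmeasurable F ->
  bmeasurable (fun x => \int[P]_y F (x, y)).
Proof.
move=> [mF [b hb]]; split; last first.
  exists b => x; apply: Ex_norm_le => //; split; first exact: measurable_fun_pair2.
  by exists b.
pose G z := ((F z + b)%:E)%E.
have mG : measurable_fun setT G.
  by apply/measurable_EFinP; apply: measurable_funD.
have G0 z : (0 <= G z)%E.
  by rewrite lee_fin; have := hb z; rewrite ler_norml => /andP[+ _]; lra.
have H := measurable_fun_fubini_tonelli_F (m2 := P) G mG G0.
rewrite (_ : (fun _ => _) = (fun x => fine (fubini_F P G x) - b)).
  apply: measurable_funB => //.
  by apply: measurableT_comp H; exact: fine_measurable.
apply/funext => x; rewrite /fubini_F -[fine _]/(\int[P]_y (F (x, y) + b)) ExD.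
- by rewrite Ex_cst addrK.
- by split; [exact: measurable_fun_pair2|exists b].
- exact: bmeasurable_cst.
Qed.

Variables (P1 : probability T1 R) (P2 : probability T2 R) (F : T1 * T2 -> R).
Hypothesis bF : bmeasurable F.

Let iF : (P1 \x P2)%E.-integrable setT (EFin \o F).
Proof.
have [mF [b hb]] := bF.
apply: measurable_bounded_integrable => //.
  rewrite -setXTT [X in (X < _)%E]product_measure1E// ltey_eq fin_numM//;
    exact: fin_num_measure.
exists b; split; first exact: num_real.
by move=> M bM x _ /=; apply: (le_trans (hb x)); exact: ltW.
Qed.

Lemma Ex_prod :
  \int[(P1 \x P2)%E]_z F z = \int[P1]_x \int[P2]_y F (x, y).
Proof.
transitivity (fine (\int[P1]_x \int[P2]_y (EFin \o F) (x, y))%E).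
  by congr fine; rewrite -integral12_prod_meas1.
congr fine; apply: eq_integral => x _.
rewrite /Rintegral fineK//; apply: integrable_fin_num => //.
exact: (bmeasurable_integrable P2 (bmeasurable_pair1 x bF)).
Qed.

Lemma Ex_fubini :
  \int[P1]_x \int[P2]_y F (x, y) = \int[P2]_y \int[P1]_x F (x, y).
Proof.
rewrite -Ex_prod; transitivity (fine (\int[P2]_y \int[P1]_x (EFin \o F) (x, y))%E).
  by congr fine; rewrite -[LHS]integral21_prod_meas1.
congr fine; apply: eq_integral => y _.
rewrite /Rintegral fineK//; apply: integrable_fin_num => //.
exact: (bmeasurable_integrable P1 (bmeasurable_pair2 y bF)).
Qed.

End fubini.

(** * Expectations over independent observations *)

Section list_functionals.
Context (d : measure_display) (A : measurableType d).

Fixpoint all_measurable (d' : measure_display) (Th : measurableType d')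
    (xs : seq (Th -> A)) : Prop :=
  if xs is x :: xs' then measurable_fun setT x /\ all_measurable xs' else True.

Lemma all_measurable_cat (d' : measure_display) (Th : measurableType d')
    (xs ys : seq (Th -> A)) : all_measurable (xs ++ ys) <-> all_measurable xs /\ all_measurable ys.
Proof.
elim: xs => [|x xs IH] /=; first by split=> [|[]].
by rewrite IH; tauto.
Qed.

Lemma all_measurable_precomp (d1 d2 : measure_display) (T1 : measurableType d1)
    (T2 : measurableType d2) (g : T1 -> T2) (xs : seq (T2 -> A)) :
  measurable_fun setT g -> all_measurable xs -> all_measurable [seq x \o g | x <- xs].
Proof.
move=> mg; elim: xs => //= x xs IH [mx /IH mxs]; split => //.
exact: measurableT_comp.
Qed.

Lemma all_measurable_cst (d' : measure_display) (Th : measurableType d')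
  (s : seq A) :
  all_measurable [seq (fun=> x) : Th -> A | x <- s].
Proof. by elim: s => //= x s IH; split => //; exact: measurable_cst. Qed.

Lemma all_measurable_nth (d' : measure_display) (Th : measurableType d')
    (x0 : Th -> A) (xs : seq (Th -> A)) i :
  measurable_fun setT x0 -> all_measurable xs -> measurable_fun setT (nth x0 xs i).
Proof. by move=> mx0; elim: xs i => [|x xs IH] [|i]//= [mx mxs]; auto. Qed.

Definition eval_seq (d' : measure_display) (Th : measurableType d')
  (xs : seq (Th -> A)) (th : Th) : seq A := [seq x th | x <- xs].

Lemma eval_seq_nth (d' : measure_display) (Th : measurableType d') (x0 : A)
    (xs : seq (Th -> A)) i th : nth x0 (eval_seq xs th) i = nth (fun=> x0) xs i th.
Proof.
have [ixs|ixs] := ltnP i (size xs); first by rewrite (nth_map (fun=> x0)).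
by rewrite !nth_default// size_map.
Qed.

(** Lists of all lengths are treated at once: a functional is measurable if it
    gives measurable functions whenever measurable functions on some space are
    substituted for the elements of a list. *)
Definition seq_measurable (d2 : measure_display) (B : measurableType d2)
    (f : seq A -> B) : Prop :=
  forall (d' : measure_display) (Th : measurableType d') (xs : seq (Th -> A)),
    all_measurable xs -> measurable_fun setT (fun th => f (eval_seq xs th)).

Context (R : realType).

Definition seq_bmeasurable (f : seq A -> R) : Prop :=
  seq_measurable f /\ forall n, exists b : R, forall s, size s = n -> `|f s| <= b.

Lemma seq_bmeasurable_eval (f : seq A -> R) (d' : measure_display)
    (Th : measurableType d') (xs : seq (Th -> A)) :
  seq_bmeasurable f -> all_measurable xs -> bmeasurable (fun th => f (eval_seq xs th)).
Proof.
move=> [mf bf] mxs; split; first exact: mf.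
have [b hb] := bf (size xs); exists b => th.
by apply: hb; rewrite size_map.
Qed.

Lemma seq_bmeasurable_cst c : seq_bmeasurable (fun=> c).
Proof.
split=> [d' Th xs mxs|n]; first exact: measurable_cst.
by exists `|c|.
Qed.

Lemma seq_bmeasurableD f g : seq_bmeasurable f -> seq_bmeasurable g ->
  seq_bmeasurable (fun s => f s + g s).
Proof.
move=> [mf bf] [mg bg]; split=> [d' Th xs mxs|n].
  by apply: measurable_funD; [exact: mf|exact: mg].
have [b hb] := bf n; have [c hc] := bg n.
by exists (b + c) => s sn; rewrite (le_trans (ler_normD _ _))// lerD// ?hb ?hc.
Qed.

Lemma seq_bmeasurableM f g : seq_bmeasurable f -> seq_bmeasurable g ->
  seq_bmeasurable (fun s => f s * g s).
Proof.
move=> [mf bf] [mg bg]; split=> [d' Th xs mxs|n].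
  by apply: measurable_funM; [exact: mf|exact: mg].
have [b hb] := bf n; have [c hc] := bg n.
by exists (b * c) => s sn; rewrite normrM ler_pM// ?hb ?hc.
Qed.

Lemma seq_bmeasurableN f : seq_bmeasurable f ->
  seq_bmeasurable (fun s => - f s).
Proof.
move=> [mf bf]; split=> [d' Th xs mxs|n].
  by apply: measurableT_comp; [exact: oppr_measurable|exact: mf].
by have [b hb] := bf n; exists b => s sn; rewrite normrN hb.
Qed.

Lemma seq_bmeasurableB f g : seq_bmeasurable f -> seq_bmeasurable g ->
  seq_bmeasurable (fun s => f s - g s).
Proof. by move=> bf bg; apply: seq_bmeasurableD => //; exact: seq_bmeasurableN. Qed.

Lemma seq_bmeasurable_sum (I : Type) (r : seq I) (F : I -> seq A -> R) :
  (forall i, seq_bmeasurable (F i)) -> seq_bmeasurable (fun s => \sum_(i <- r) F i s).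
Proof.
move=> bF; elim: r => [|i r IH].
  rewrite (_ : (fun _ => _) = (fun=> 0)); first exact: seq_bmeasurable_cst.
  by apply/funext => s; rewrite big_nil.
rewrite (_ : (fun _ => _) = (fun s => F i s + \sum_(i <- r) F i s)).
  exact: seq_bmeasurableD.
by apply/funext => s; rewrite big_cons.
Qed.

Lemma seq_bmeasurable_expR f : seq_bmeasurable f ->
  seq_bmeasurable (fun s => expR (f s)).
Proof.
move=> [mf bf]; split=> [d' Th xs mxs|n].
  by apply: measurableT_comp; [exact: measurable_expR|exact: mf].
have [b hb] := bf n; exists (expR b) => s sn.
rewrite ger0_norm ?expR_ge0// ler_expR (le_trans _ (hb s sn))//.
exact: ler_norm.
Qed.

Lemma seq_bmeasurable_bool (b : seq A -> bool) : seq_measurable b ->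
  seq_bmeasurable (fun s => (b s)%:R).
Proof.
move=> mb; split=> [d' Th xs mxs|n].
  by have [] := @bmeasurable_bool R _ _ _ (mb _ _ _ mxs).
by exists 1 => s _; case: (b s); rewrite ?normr1 ?normr0 ?lexx ?ler01.
Qed.

Lemma seq_bmeasurable_cat (f : seq A -> R) t : seq_bmeasurable f ->
  seq_bmeasurable (fun s => f (t ++ s)).
Proof.
move=> [mf bf]; split=> [d' Th xs mxs|n]; last first.
  have [b hb] := bf (size t + n)%N; exists b => s sn.
  by apply: hb; rewrite size_cat sn.
have := @mf d' Th ([seq (fun=> x) : Th -> A | x <- t] ++ xs).
rewrite all_measurable_cat => /(_ (conj (all_measurable_cst _ t) mxs)).
congr measurable_fun; apply/funext => th.
by rewrite /eval_seq map_cat -map_comp map_id_in.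
Qed.

Lemma seq_bmeasurable_cons (f : seq A -> R) w : seq_bmeasurable f ->
  seq_bmeasurable (fun s => f (w :: s)).
Proof. exact: (@seq_bmeasurable_cat f [:: w]). Qed.

Lemma seq_bmeasurable_rem (G : seq A -> R) (x0 : A) i : seq_bmeasurable G ->
  seq_bmeasurable (fun s => G (nth x0 s i :: take i s ++ drop i.+1 s)).
Proof.
move=> [mG bG]; split=> [d' Th xs mxs|n].
  have mtd k : all_measurable (take k xs) /\ all_measurable (drop k xs).
    by apply/all_measurable_cat; rewrite cat_take_drop.
  have := mG d' Th (nth (fun=> x0) xs i :: take i xs ++ drop i.+1 xs).
  rewrite /= all_measurable_cat; case: (mtd i) (mtd i.+1) => [m1 _] [_ m2].
  move=> /(_ (conj (all_measurable_nth _ (measurable_cst _) mxs) (conj m1 m2))).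
  congr measurable_fun; apply/funext => th /=.
  by rewrite -eval_seq_nth /eval_seq map_cat map_take map_drop.
have [b hb] := bG (minn i n + (n - i.+1)).+1; exists b => s sn; apply: hb.
by rewrite /= size_cat size_take_min size_drop sn.
Qed.

End list_functionals.

Lemma all_measurable_map (d1 d2 d3 : measure_display) (T1 : measurableType d1)
    (T2 : measurableType d2) (T3 : measurableType d3) (g : T2 -> T3)
    (xs : seq (T1 -> T2)) :
  measurable_fun setT g -> all_measurable xs -> all_measurable [seq g \o x | x <- xs].
Proof.
move=> mg; elim: xs => //= x xs IH [mx /IH mxs]; split => //.
exact: measurableT_comp.
Qed.

Section iterated.
Context (d : measure_display) (A : measurableType d) (R : realType).
Variable P : probability A R.

(** Expectation over [n] independent observations, as an iterated integral. *)
Fixpoint iid_mean (n : nat) (f : seq A -> R) : R :=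
  if n is n'.+1 then \int[P]_w iid_mean n' (fun s => f (w :: s)) else f [::].

Lemma iid_mean_eq n f g : (forall s, size s = n -> f s = g s) ->
  iid_mean n f = iid_mean n g.
Proof.
elim: n f g => [|n IH] f g fg /=; first exact: fg.
by apply: Ex_eq => w; apply: IH => s sn; apply: fg; rewrite /= sn.
Qed.

(** Boundedness, and measurability in the arguments that are not integrated, are
    proved together, as each integration requires both of the inner integral. *)
Lemma iid_mean_seq_bmeasurable n :
  (forall (F : seq A -> R) b, seq_bmeasurable F ->
     (forall s, size s = n -> `|F s| <= b) -> `|iid_mean n F| <= b) /\
  (forall F : seq A -> R, seq_bmeasurable F -> seq_bmeasurable (fun s => iid_mean n (fun s' => F (s ++ s')))).
Proof.
elim: n => [|n [IHb IH]].
  split=> [F b _ /(_ [::])|F bF]; first exact.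
  rewrite (_ : (fun _ => _) = F)//.
  by apply/funext => s /=; rewrite cats0.
have bound (F : seq A -> R) b : seq_bmeasurable F ->
    (forall s, size s = n.+1 -> `|F s| <= b) -> `|iid_mean n.+1 F| <= b.
  move=> bF hb /=; apply: Ex_norm_le => [|w].
    have := @seq_bmeasurable_eval _ _ _ _ _ _ [:: id] (IH F bF).
    by apply; split => //; exact: measurable_id.
  by apply: IHb => [|s sn]; [exact: seq_bmeasurable_cons|apply: hb; rewrite /= sn].
split=> // F bF; split=> [d' Th xs mxs|k]; last first.
  have [_ /(_ (k + n.+1)%N)[b hb]] := bF; exists b => s sk.
  apply: bound; first exact: seq_bmeasurable_cat.
  by move=> s' s'n; apply: hb; rewrite size_cat sk s'n.
pose ys : seq (Th * A -> A) := [seq x \o fst | x <- xs] ++ [:: snd].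
have mys : all_measurable ys.
  by rewrite all_measurable_cat; split=> //=; exact: all_measurable_precomp.
have [m _] := bmeasurable_Ex P (seq_bmeasurable_eval (IH F bF) mys).
move: m; congr measurable_fun; apply/funext => th; apply: Ex_eq => w.
apply: iid_mean_eq => s sn.
by rewrite /ys /eval_seq map_cat -map_comp /= -catA.
Qed.

Lemma seq_bmeasurable_iid_mean n F : seq_bmeasurable F ->
  seq_bmeasurable (fun s => iid_mean n (fun s' => F (s ++ s'))).
Proof. by have [_] := iid_mean_seq_bmeasurable n; apply. Qed.

Lemma iid_mean_norm_le n F b : seq_bmeasurable F ->
  (forall s, size s = n -> `|F s| <= b) -> `|iid_mean n F| <= b.
Proof. by have [+ _] := iid_mean_seq_bmeasurable n; apply. Qed.

Lemma bmeasurable_iid_mean n F : seq_bmeasurable F ->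
  bmeasurable (fun w => iid_mean n (fun s => F (w :: s))).
Proof.
move=> bF; have := @seq_bmeasurable_eval _ _ _ _ _ _ [:: id] (seq_bmeasurable_iid_mean n bF).
by apply; split => //; exact: measurable_id.
Qed.

Lemma iid_mean_cst n c : iid_mean n (fun=> c) = c.
Proof.
by elim: n => //= n IH; rewrite (Ex_eq P (g := fun=> c))// Ex_cst.
Qed.

Lemma iid_meanD n f g : seq_bmeasurable f -> seq_bmeasurable g ->
  iid_mean n (fun s => f s + g s) = iid_mean n f + iid_mean n g.
Proof.
elim: n f g => //= n IH f g bf bg.
rewrite -ExD; [|exact: bmeasurable_iid_mean..].
by apply: Ex_eq => w; rewrite IH//; exact: seq_bmeasurable_cons.
Qed.

Lemma iid_meanZl n c f : seq_bmeasurable f -> iid_mean n (fun s => c * f s)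
  = c * iid_mean n f.
Proof.
elim: n f => //= n IH f bf; rewrite -ExZl; last exact: bmeasurable_iid_mean.
by apply: Ex_eq => w; rewrite IH//; exact: seq_bmeasurable_cons.
Qed.

Lemma iid_meanZr n c f : seq_bmeasurable f -> iid_mean n (fun s => f s * c)
  = iid_mean n f * c.
Proof.
by move=> bf; rewrite mulrC -iid_meanZl//; apply: iid_mean_eq => s _; rewrite mulrC.
Qed.

Lemma iid_meanN n f : seq_bmeasurable f -> iid_mean n (fun s => - f s)
  = - iid_mean n f.
Proof.
by move=> bf; rewrite -mulN1r -iid_meanZl//; apply: iid_mean_eq => s _; rewrite mulN1r.
Qed.

Lemma iid_meanB n f g : seq_bmeasurable f -> seq_bmeasurable g ->
  iid_mean n (fun s => f s - g s) = iid_mean n f - iid_mean n g.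
Proof. by move=> bf bg; rewrite iid_meanD ?iid_meanN//; exact: seq_bmeasurableN. Qed.

Lemma iid_mean_sum (I : Type) (r : seq I) (F : I -> seq A -> R) n :
  (forall i, seq_bmeasurable (F i)) ->
  iid_mean n (fun s => \sum_(i <- r) F i s) = \sum_(i <- r) iid_mean n (F i).
Proof.
move=> bF; elim: r => [|i r IH].
  by rewrite big_nil -[RHS](iid_mean_cst n); apply: iid_mean_eq => s _; rewrite big_nil.
rewrite big_cons -IH -iid_meanD//; last exact: seq_bmeasurable_sum.
by apply: iid_mean_eq => s _; rewrite big_cons.
Qed.

Lemma le_iid_mean n f g : seq_bmeasurable f -> seq_bmeasurable g ->
  (forall s, size s = n -> f s <= g s) -> iid_mean n f <= iid_mean n g.
Proof.
elim: n f g => [|n IH] f g bf bg fg /=; first exact: fg.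
apply: le_Ex => [||w]; [exact: bmeasurable_iid_mean..|].
by apply: IH => [||s sn]; [exact: seq_bmeasurable_cons..|apply: fg; rewrite /= sn].
Qed.

Lemma iid_mean_rcons n f :
  iid_mean n.+1 f = iid_mean n (fun s => \int[P]_w f (rcons s w)).
Proof.
elim: n f => // n IH f.
by rewrite -[LHS]/(\int[P]_w iid_mean n.+1 _) (Ex_eq P (fun w => IH _)).
Qed.

(** Fubini: any one observation may be moved to the front, where it is
    integrated last. *)
Lemma iid_mean_nth n (x0 : A) (G : seq A -> R) i : (i <= n)%N ->
  seq_bmeasurable G ->
  iid_mean n.+1 (fun s => G (nth x0 s i :: take i s ++ drop i.+1 s)) = iid_mean n.+1 G.
Proof.
elim: i n G => [|i IH] n G.
  by move=> _ _; apply: iid_mean_eq => -[//|x s] _ /=; rewrite drop0.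
case: n => // n ilen bG.
pose G' w t := if t is x :: t' then G [:: x, w & t'] else 0.
have bG' w : seq_bmeasurable (G' w).
  split=> [d' Th [|x xs] mxs|k]; first exact: measurable_cst.
    have [mG _] := bG; apply: (mG d' Th [:: x, fun=> w & xs]).
    by case: mxs => mx mxs; split=> //; split=> //; exact: measurable_cst.
  have [_ /(_ k.+1)[b hb]] := bG; exists (`|b|) => -[|x s] sk /=.
    by rewrite normr0.
  by rewrite (le_trans (hb _ _) (ler_norm b))//= -sk.
rewrite [LHS]/= (Ex_eq P (g := fun w => iid_mean n.+1 (G' w))); last first.
  move=> w; rewrite -(IH _ (G' w))//.
have H : bmeasurable (fun z : A * A => iid_mean n (fun s => G [:: z.1, z.2 & s])).
  have := @seq_bmeasurable_eval _ _ _ _ _ _ [:: fst; snd] (seq_bmeasurable_iid_mean n bG).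
  by apply; split => //; split.
by rewrite /= -(Ex_fubini P P H).
Qed.

End iterated.

(** * The bounded difference inequality *)

Section concentration.
Context (R : realType).

(** Square [exp (x / 2) <= 1 / (1 - x / 2)]; for [x <= 1 / 3] the quadratic
    polynomial exceeds the square of the right-hand side. *)
Lemma expR_le_quadratic (x : R) : x <= 1/3 -> expR x <= 1 + x + x ^+ 2.
Proof.
move=> x3.
have h : 1 - x / 2 <= expR (- (x / 2)) by have := expR_ge1Dx (- (x / 2)).
have p : 0 < 1 - x / 2 by lra.
have e : expR (x / 2) <= (1 - x / 2)^-1.
  by rewrite -[leLHS]invrK lef_pV2 ?posrE ?invr_gt0 ?expR_gt0// -expRN.
have -> : expR x = expR (x / 2) ^+ 2.
  by rewrite expr2 -expRD; congr expR; field.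
have e2 : expR (x / 2) ^+ 2 <= ((1 - x / 2)^-1) ^+ 2.
  by rewrite ler_pXn2r ?nnegrE ?expR_ge0 ?invr_ge0 ?(ltW p).
apply: (le_trans e2); rewrite exprVn -[leLHS]mul1r ler_pdivrMr ?exprn_gt0//.
have q : 0 <= x ^+ 2 / 4 * (1 - 3 * x + x ^+ 2).
  by apply: mulr_ge0; [apply: divr_ge0 => //; exact: sqr_ge0|have := sqr_ge0 x; lra].
rewrite -subr_ge0 (_ : _ - _ = x ^+ 2 / 4 * (1 - 3 * x + x ^+ 2))//.
by field.
Qed.

Context (d : measure_display) (A : measurableType d).
Variable P : probability A R.

Definition bounded_diff (n : nat) (c : R) (f : seq A -> R) :=
  forall s1 x y s2, size (s1 ++ x :: s2) = n ->
    `|f (s1 ++ x :: s2) - f (s1 ++ y :: s2)| <= c.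

(** Integrate one observation at a time. The mean [g] over the later ones varies
    by at most [c] with the first; for a centered variable bounded by [c], the
    quadratic bound on the exponential function gives the factor
    [1 + (l * c) ^+ 2 <= expR ((l * c) ^+ 2)]. *)
Lemma iid_mean_mgf n (f : seq A -> R) (c l : R) : seq_bmeasurable f ->
  bounded_diff n c f ->
  `|l| * c <= 1/3 ->
  iid_mean P n (fun s => expR (l * (f s - iid_mean P n f))) <= expR (n%:R * (l * c) ^+ 2).
Proof.
move=> + + lc; elim: n f => [|n IH] f bf bd.
  by rewrite /= subrr mulr0 mul0r.
pose g w := iid_mean P n (fun s => f (w :: s)).
have bg : bmeasurable g by exact: bmeasurable_iid_mean.
have gg w w' : `|g w - g w'| <= c.
  rewrite /g -iid_meanB; [|exact: seq_bmeasurable_cons..].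
  apply: iid_mean_norm_le => [|s sn]; first by apply: seq_bmeasurableB; exact: seq_bmeasurable_cons.
  by apply: (bd [::]); rewrite /= sn.
pose m := \int[P]_w g w.
have gm w : `|g w - m| <= c.
  rewrite /m -[X in X - _](Ex_cst P) -ExB//; last exact: bmeasurable_cst.
  by apply: Ex_norm_le => // ; apply: bmeasurableB => //; exact: bmeasurable_cst.
have c0 : 0 <= c := le_trans (normr_ge0 _) (gg point point).
set K := expR (n%:R * (l * c) ^+ 2).
have step w : iid_mean P n (fun s => expR (l * (f (w :: s) - m))) <=
              (1 + l * (g w - m) + (l * c) ^+ 2) * K.
  rewrite (_ : iid_mean P n _ = expR (l * (g w - m)) *
      iid_mean P n (fun s => expR (l * (f (w :: s) - g w)))); last first.
    rewrite -iid_meanZl.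
      by apply: iid_mean_eq => s _; rewrite -expRD; congr expR; ring.
    apply: seq_bmeasurable_expR; apply: seq_bmeasurableM; first exact: seq_bmeasurable_cst.
    by apply: seq_bmeasurableB; [exact: seq_bmeasurable_cons|exact: seq_bmeasurable_cst].
  have l1 : `|l * (g w - m)| <= `|l| * c by rewrite normrM ler_wpM2l.
  apply: ler_pM; first exact: expR_ge0.
  - rewrite -(iid_mean_cst P n 0); apply: le_iid_mean; first exact: seq_bmeasurable_cst.
      apply: seq_bmeasurable_expR; apply: seq_bmeasurableM; first exact: seq_bmeasurable_cst.
      by apply: seq_bmeasurableB; [exact: seq_bmeasurable_cons|exact: seq_bmeasurable_cst].
    by move=> s _; exact: expR_ge0.
  - apply: (le_trans (expR_le_quadratic _)).
      by rewrite (le_trans (ler_norm _))// (le_trans l1).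
    rewrite lerD2l -[leLHS]real_normK ?num_real//.
    rewrite -[leRHS]real_normK ?num_real// [X in _ <= X ^+ 2]normrM (ger0_norm c0).
    by rewrite ler_pXn2r// nnegrE// mulr_ge0.
  - apply: IH; first exact: seq_bmeasurable_cons.
    by move=> s1 x y s2 sn; apply: (bd (w :: s1)); rewrite /= sn.
rewrite [leLHS]/= -/m.
have bstep : bmeasurable (fun w => (1 + l * (g w - m) + (l * c) ^+ 2) * K).
  by do ?[apply: bmeasurableM|apply: bmeasurableD|exact: bmeasurable_cst|exact: bg|exact: bmeasurableN].
apply: (@le_trans _ _ (\int[P]_w ((1 + l * (g w - m) + (l * c) ^+ 2) * K))).
  apply: le_Ex => //; apply: (@bmeasurable_iid_mean _ _ _ P n (fun s => expR (l * (f s - m)))).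
  apply: seq_bmeasurable_expR; apply: seq_bmeasurableM; first exact: seq_bmeasurable_cst.
  by apply: seq_bmeasurableB; [exact: bf|exact: seq_bmeasurable_cst].
rewrite (_ : \int[P]_w _ = (1 + (l * c) ^+ 2) * K).
  rewrite [X in expR X](_ : _ = (l * c) ^+ 2 + n%:R * (l * c) ^+ 2).
    by rewrite expRD ler_wpM2r ?expR_ge0// expR_ge1Dx.
  by rewrite -natr1 mulrDl mul1r addrC.
rewrite ExZr; last first.
  by do ?[apply: bmeasurableM|apply: bmeasurableD|exact: bmeasurable_cst|exact: bg|exact: bmeasurableN].
congr (_ * K).
rewrite ExD; [|by do ?[apply: bmeasurableM|apply: bmeasurableD|exact: bmeasurable_cst|exact: bg|exact: bmeasurableN]..].
rewrite ExD; [|by do ?[apply: bmeasurableM|apply: bmeasurableD|exact: bmeasurable_cst|exact: bg|exact: bmeasurableN]..].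
rewrite ExZl; last by apply: bmeasurableB => //; exact: bmeasurable_cst.
rewrite ExB//; last exact: bmeasurable_cst.
by rewrite !Ex_cst -/m subrr mulr0 addr0.
Qed.

Lemma seq_measurable_ler (f g : seq A -> R) : seq_bmeasurable f ->
  seq_bmeasurable g ->
  seq_measurable (fun s => f s <= g s).
Proof.
move=> [mf _] [mg _] d' Th xs mxs.
by apply: measurable_fun_ler; [exact: mf|exact: mg].
Qed.

(** Chernoff's bound for the bounded difference inequality. *)
Lemma iid_mean_tail n (f : seq A -> R) (c l t : R) : seq_bmeasurable f ->
  bounded_diff n c f ->
  0 <= l -> l * c <= 1/3 ->
  iid_mean P n (fun s => (t <= f s - iid_mean P n f)%R%:R) <=
  expR (n%:R * (l * c) ^+ 2 - l * t).
Proof.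
move=> bf bd l0 lc.
have be : seq_bmeasurable (fun s => expR (l * (f s - iid_mean P n f))).
  apply: seq_bmeasurable_expR; apply: seq_bmeasurableM; first exact: seq_bmeasurable_cst.
  by apply: seq_bmeasurableB => //; exact: seq_bmeasurable_cst.
rewrite expRD; apply: le_trans (ler_wpM2r (expR_ge0 _) _); last first.
  by apply: iid_mean_mgf bd _ => //; rewrite ger0_norm.
rewrite -iid_meanZr//; apply: le_iid_mean.
- apply: seq_bmeasurable_bool; apply: seq_measurable_ler; first exact: seq_bmeasurable_cst.
  by apply: seq_bmeasurableB => //; exact: seq_bmeasurable_cst.
- by apply: seq_bmeasurableM => //; exact: seq_bmeasurable_cst.
move=> s _; case: (lerP t) => h; last by rewrite mulr_ge0 ?expR_ge0.
by rewrite -expRD -[leLHS]expR0 ler_expR -mulrN -mulrDr mulr_ge0// subr_ge0.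
Qed.

End concentration.

(** * The law of an independent sample *)

Section transfer.
Context (R : realType) (dO : measure_display) (Om : measurableType dO).
Variable P : probability Om R.

Definition to_mfun (d1 d2 : measure_display) (T1 : measurableType d1)
    (T2 : measurableType d2) (f : T1 -> T2) (mf : measurable_fun setT f) :
    {mfun T1 >-> T2} :=
  MeasurableFun.Pack (MeasurableFun.Class (isMeasurableFun.Build _ _ _ _ f mf)).

Lemma Ex_distribution (d1 : measure_display) (T1 : measurableType d1)
    (X : {mfun Om >-> T1}) (g : T1 -> R) : bmeasurable g ->
  \int[distribution P X]_y g y = \int[P]_w g (X w).
Proof.
move=> bg; congr fine; rewrite integral_distribution//.
  by apply/measurable_EFinP; case: bg.
by apply: (bmeasurable_integrable P (g := g \o X)); exact: bmeasurable_comp.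
Qed.

(** The joint law is the product of the two marginal laws, to which Fubini's
    theorem applies. *)
Lemma independent2_Ex (d1 d2 : measure_display) (T1 : measurableType d1)
    (T2 : measurableType d2) (X1 : Om -> T1) (X2 : Om -> T2)
    (F : T1 * T2 -> R) :
  measurable_fun setT X1 -> measurable_fun setT X2 ->
  independent2 P X1 X2 -> bmeasurable F ->
  \int[P]_w F (X1 w, X2 w) = \int[P]_w \int[P]_w' F (X1 w, X2 w').
Proof.
move=> m1 m2 ind bF.
pose Y1 := to_mfun m1; pose Y2 := to_mfun m2.
pose Y := to_mfun (measurable_fun_pair m1 m2).
transitivity (\int[distribution P Y]_z F z); first by rewrite Ex_distribution.
transitivity (\int[(distribution P Y1 \x distribution P Y2)%E]_z F z).
  congr fine; apply: eq_measure_integral => B mB _.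
  apply/esym/product_measure_unique => //.
rewrite Ex_prod// Ex_distribution; last exact: bmeasurable_Ex.
by apply: Ex_eq => w; rewrite Ex_distribution//; exact: bmeasurable_pair1.
Qed.

Context (d : measure_display) (S : measurableType d) (I : finType).
Variables (Xs : I -> Om -> S) (X : Om -> S).
Hypothesis mXs : forall i, measurable_fun setT (Xs i).
Hypothesis mX : measurable_fun setT X.
Hypothesis iidX : forall (J : {set I}) (A : I -> set S),
  (forall i, i \in J -> measurable (A i)) ->
  P (\bigcap_(i in [set` J]) (Xs i @^-1` A i)) = (\prod_(i in J) P (X @^-1` A i))%E.

Let tup (l : seq I) (w : Om) : (size l).-tuple S :=
  map_tuple (fun i => Xs i w) (in_tuple l).

Let mtup l : measurable_fun setT (tup l).
Proof.
apply/measurable_fun_tnthP => j; rewrite (_ : _ \o _ = Xs (tnth (in_tuple l) j))//.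
by apply/funext => w /=; rewrite tnth_map.
Qed.

Let preX i A : measurable A -> measurable (Xs i @^-1` A).
Proof. by move=> mA; rewrite -[X in measurable X]setTI; exact: mXs. Qed.

(** For fixed [A] both sides are measures in the event for the tuple; they agree
    on boxes, which are stable under intersection and generate. *)
Let ind_tup i l : i \notin l -> independent2 P (Xs i) (tup l).
Proof.
move=> il A B mA mB; pose J := [set k in l].
pose box (Bs : I -> set S) := \bigcap_(k in [set` J]) (Xs k @^-1` Bs k).
pose G := [set C | exists2 Bs, (forall k, measurable (Bs k)) & C = box Bs].
have sG : <<s G >> (tup l @^-1` B).
  have : measurable_fun [set: g_sigma_algebraType G] (tup l : g_sigma_algebraType G -> _).
    apply/measurable_fun_tnthP => j _ C mC; rewrite setTI.
    apply: sub_sigma_algebra.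
    exists (fun k => if k == tnth (in_tuple l) j then C else setT).
      by move=> k; case: ifP.
    apply/seteqP; split => w /=; rewrite tnth_map.
      by move=> Cw k _ /=; case: ifP => // /eqP ->.
    move=> /(_ (tnth (in_tuple l) j)) /=; rewrite eqxx; apply.
    by rewrite inE (mem_tnth j (in_tuple l)).
  by move=> /(_ measurableT B mB); rewrite setTI.
have mAi := preX i mA.
have boxm Bs : (forall k, measurable (Bs k)) -> measurable (box Bs).
  move=> mBs; apply: fin_bigcap_measurable => //.
  by move=> k _; exact: preX.
have nn : (0 <= fine (P (Xs i @^-1` A)))%R by rewrite fine_ge0.
have PAE : P (Xs i @^-1` A) = (fine (P (Xs i @^-1` A)))%:E by rewrite fineK// fin_num_measure.
have PA : P (Xs i @^-1` A) = P (X @^-1` A).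
  have := @iidX [set i] (fun=> A) (fun _ _ => mA); rewrite big_set1 => <-.
  congr (P _); apply/seteqP; split => [w Aw k|w Aw] /=.
    by rewrite inE => /eqP ->.
  by apply: (Aw i); rewrite /= inE.
rewrite setIC PAE.
apply: (@g_sigma_algebra_measure_unique _ _ _ G _ (fun=> setT) _ _ (mrestr P mAi) (mscale (NngNum nn) P)) sG.
- by move=> C [Bs mBs ->]; exact: boxm.
- move=> _; exists (fun=> setT) => //; apply/seteqP; split => //.
- exact: bigcup_const.
- move=> C D [Bs mBs ->] [Cs mCs ->]; exists (fun k => Bs k `&` Cs k).
    by move=> k; exact: measurableI.
  by rewrite /box -bigcapI.
- move=> C [Bs mBs ->]; rewrite /= /mrestr /mscale /= -PAE.
  rewrite iidX; last by move=> k _; exact: mBs.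
  pose A' k := if k == i then A else Bs k.
  have := @iidX (i |: J) A'; rewrite big_setU1 ?inE//=.
  have -> : A' i = A by rewrite /A' eqxx.
  move=> H; rewrite PA [in RHS](eq_bigr (fun k => P (X @^-1` A' k))); last first.
    move=> k; rewrite inE => kl; rewrite /A'; case: eqP => // ki.
    by rewrite ki (negbTE il) in kl.
  rewrite -H; last by move=> k _; rewrite /A'; case: ifP.
  congr (P _); apply/seteqP; split => [w [bw Aw] k /=|w Hw].
    rewrite !inE /A'; case: eqP => [->//|_ /= kl].
    by apply: bw; rewrite /= inE.
  split; last by have := Hw i; rewrite /= !inE eqxx /A' eqxx; apply.
  move=> k; rewrite /= inE => kl; have := Hw k; rewrite /= !inE kl orbT /A'.
  by case: eqP => [ki|_]; [rewrite ki (negbTE il) in kl|apply].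
- by move=> _; rewrite /= /mrestr setTI ltey_eq fin_num_measure.
Qed.

(** By induction on the sample: one observation is independent of the tuple of
    the others, so that it can be integrated separately. *)
Lemma iid_sample_mean (f : seq S -> R) (l : seq I) : seq_bmeasurable f ->
  uniq l ->
  \int[P]_w f [seq Xs i w | i <- l] =
  iid_mean P (size l) (fun ws => f [seq X w | w <- ws]).
Proof.
elim: l f => [|i l IH] f bf /=; first by move=> _; rewrite Ex_cst.
move=> /andP[il ul].
pose F (z : S * (size l).-tuple S) := f (z.1 :: tval z.2).
have bF : bmeasurable F.
  pose ys := fst :: [seq (fun z : S * (size l).-tuple S => tnth z.2 j) | j <- enum 'I_(size l)].
  have : bmeasurable (fun z => f (eval_seq ys z)).
    apply: seq_bmeasurable_eval => //; split=> //; elim: (enum _) => //= j e IHe; split => //.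
    by apply: (measurableT_comp (measurable_tnth j)).
  congr bmeasurable; apply/funext => z; rewrite /F /eval_seq /= -map_comp.
  by congr (f (_ :: _)); rewrite -[RHS]map_tnth_enum.
have H := independent2_Ex (mXs i) (@mtup l) (ind_tup il) bF.
rewrite [LHS]H.
have law (g : S -> R) : bmeasurable g -> \int[P]_w g (Xs i w) = \int[P]_w g (X w).
  move=> bg; rewrite -(Ex_distribution (to_mfun (mXs i)) bg).
  rewrite -(Ex_distribution (to_mfun mX) bg); congr fine.
  apply: eq_measure_integral => A mA _.
  have := @iidX [set i] (fun=> A) (fun _ _ => mA); rewrite big_set1 => Hi.
  rewrite -[RHS]Hi; congr (P _); apply/seteqP; split => [w Aw k|w Aw] /=.
    by rewrite inE => /eqP ->.
  by apply: (Aw i); rewrite /= inE.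
rewrite (law (fun x => \int[P]_w' F (x, tup l w'))); last first.
  apply: (@bmeasurable_Ex _ _ _ _ _ P (fun z => F (z.1, tup l z.2))).
  have [mF [b hb]] := bF; split; last by exists b => z; exact: hb.
  apply: measurableT_comp => //; apply: measurable_fun_pair => //.
  exact: (measurableT_comp (@mtup l)).
apply: Ex_eq => w.
by rewrite -(IH (fun s => f (X w :: s)))//; exact: seq_bmeasurable_cons.
Qed.

End transfer.

(** * Kaplan--Meier integrals *)

Section km_integral.
Context (R : realType).

Local Notation pt := (R * bool * R)%type.
Implicit Types (x y : pt) (s t : seq pt).

Definition utime x : R := x.1.1.
Definition failed x : bool := x.1.2.
Definition mark x : R := x.2.

(** At equal times failures precede censorings, as in the Kaplan--Meier
    estimator. Comparing the marks last makes the order antisymmetric, so that a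
    sorted list depends on the multiset of its elements only. *)
Definition obs_le x y : bool :=
  (utime x < utime y) || (utime x == utime y) &&
    ((failed x && ~~ failed y) || (failed x == failed y) && (mark x <= mark y)).

Lemma obs_le_total : total obs_le.
Proof.
move=> [[u b] v] [[u' b'] v']; rewrite /obs_le /utime /failed /mark /=.
case: (ltgtP u u') => //= _.
by case: b; case: b' => //=; exact: le_total.
Qed.

Lemma obs_le_trans : transitive obs_le.
Proof.
move=> [[u b] v] [[u1 b1] v1] [[u2 b2] v2]; rewrite /obs_le /utime /failed /mark /=.
case: (ltgtP u1 u) => //= [h1|->].
  by case: (ltgtP u u2) => //= [h2|<-] _; rewrite ?(lt_trans h1 h2) ?h1.
case: (ltgtP u u2) => //= _.
by case: b; case: b1; case: b2 => //=; exact: le_trans.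
Qed.

Lemma obs_le_anti : antisymmetric obs_le.
Proof.
move=> [[u b] v] [[u' b'] v']; rewrite /obs_le /utime /failed /mark /=.
case: (ltgtP u u') => //= ->.
by case: b; case: b' => //= /le_anti ->.
Qed.

Lemma obs_le_utime x y : obs_le x y -> utime x <= utime y.
Proof. by move=> /orP[/ltW//|/andP[/eqP->]]. Qed.

Variable mu : R -> R.

(** The integral of the marks against the Kaplan--Meier estimator of a sorted
    sample. Of the mass that reaches it, the first observation takes the fraction
    one over the number at risk if it is a failure; if it is censored it leaves
    all to the later ones. Mass that remains at the end has the value [d], or
    [mu u] if the last observation was censored at [u]. *)
Fixpoint km_rec (d : R) (s : seq pt) : R :=
  if s is x :: s' then
    if failed x then (mark x + (size s')%:R * km_rec d s') / (size s').+1%:R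
    else km_rec (mu (utime x)) s'
  else d.

Definition km_int (d : R) (s : seq pt) : R := km_rec d (sort obs_le s).

Lemma km_int_perm d s t : perm_eq s t -> km_int d s = km_int d t.
Proof.
move=> st; rewrite /km_int; congr km_rec.
by apply/perm_sortP => //; [exact: obs_le_total|exact: obs_le_trans|exact: obs_le_anti].
Qed.

Definition unit_mark : pred pt := fun x => 0 <= mark x <= 1.
Hypothesis mu01 : forall u, 0 <= mu u <= 1.

Lemma km_rec01 d s : 0 <= d <= 1 -> all unit_mark s -> 0 <= km_rec d s <= 1.
Proof.
elim: s d => //= x s IH d d01 /andP[/andP[x0 x1] vs].
case: ifP => _; last exact: IH.
have /andP[w0 w1] := IH d d01 vs.
have n0 : 0 <= (size s)%:R :> R by exact: ler0n.
rewrite divr_ge0 ?addr_ge0 ?mulr_ge0//= ler_pdivrMr ?ltr0Sn// mul1r.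
by rewrite -natr1 addrC lerD// ler_piMr.
Qed.

Lemma km_int01 d s : 0 <= d <= 1 -> all unit_mark s -> 0 <= km_int d s <= 1.
Proof. by move=> d01 vs; apply: km_rec01; rewrite ?all_sort. Qed.

Lemma km_rec_failed d x s : failed x ->
  (size s).+1%:R * km_rec d (x :: s) = mark x + (size s)%:R * km_rec d s.
Proof. by move=> /= ->; rewrite mulrCA divff ?mulr1// pnatr_eq0. Qed.

(** The factor [size s] vanishes for the empty list, the only one on which the
    default value has an effect. *)
Lemma km_rec_default a b s :
  (size s)%:R * km_rec a s = (size s)%:R * km_rec b s.
Proof.
elim: s => [|x s IH]; first by rewrite !mul0r.
case: (boolP (failed x)) => fx; last by rewrite /= (negbTE fx).
by rewrite !km_rec_failed// IH.
Qed.

Lemma km_rec_default_cons a b x s : km_rec a (x :: s) = km_rec b (x :: s).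
Proof.
have := km_rec_default a b (x :: s); apply: mulfI.
by rewrite pnatr_eq0.
Qed.

(** With [k] subjects at risk at its time, [x] moves the integral [w] by
    [(y - w) / k] for some [y] in the unit interval. This is clear if [x] comes
    first; an earlier failure, whose mass shrinks from [1 / j] to [1 / (j + 1)],
    preserves both inequalities since its mark lies in the unit interval and
    [k <= j]. *)
Lemma km_rec_insert d s1 x s2 (w := km_rec d (s1 ++ s2)) :
  0 <= d <= 1 -> all unit_mark s1 -> unit_mark x -> all unit_mark s2 ->
  - w <= (size s2).+1%:R * (km_rec d (s1 ++ x :: s2) - w) <= 1 - w.
Proof.
move=> d01 v1 vx v2; rewrite {}/w.
elim: s1 d d01 v1 => [|y s1 IH] d d01.
  move=> _; rewrite !cat0s; have /andP[w0 w1] := km_rec01 d01 v2.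
  have /andP[x0 x1] := vx.
  case: (boolP (failed x)) => fx.
    rewrite mulrBr km_rec_failed// -natr1 mulrDl mul1r.
    by apply/andP; split; lra.
  rewrite /= (negbTE fx).
  case: s2 v2 w0 w1 => [|y s2] v2 w0 w1.
    by have := mu01 (utime x) => /andP[m0 m1]; rewrite mul1r/=; rewrite /= in w0 w1; apply/andP; split; lra.
  by rewrite (km_rec_default_cons (mu (utime x)) d) subrr mulr0 oppr_le0 w0 subr_ge0 w1.
move=> vy1; have {vy1}/andP[vy v1] : unit_mark y && all unit_mark s1 := vy1.
case: (boolP (failed y)) => fy; last first.
  by rewrite /= (negbTE fy); exact: IH.
have {IH} := IH d d01 v1.
have vw : all unit_mark (s1 ++ s2) by rewrite all_cat v1.
have /andP[w0 w1] := km_rec01 d01 vw.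
have vw' : all unit_mark (s1 ++ x :: s2) by rewrite all_cat v1/= vx.
have := km_rec_failed d (s1 ++ s2) fy; have := km_rec_failed d (s1 ++ x :: s2) fy.
have -> : size (s1 ++ x :: s2) = (size (s1 ++ s2)).+1 by rewrite !size_cat/= addnS.
rewrite -!cat_cons.
set W := km_rec d (s1 ++ s2) in w0 w1 *; set W' := km_rec d (s1 ++ x :: s2).
set V := km_rec d ((y :: s1) ++ s2); set V' := km_rec d ((y :: s1) ++ x :: s2).
have : (size s2).+1%:R <= (size (s1 ++ s2)).+1%:R :> R by rewrite ler_nat size_cat ltnS leq_addl.
have : 1 <= (size s2).+1%:R :> R by rewrite ler1n.
have /andP[y0 y1] := vy.
have -> : (size (s1 ++ s2)).+2%:R = (size (s1 ++ s2)).+1%:R + 1 :> R by rewrite natr1.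
have -> : (size (s1 ++ s2))%:R = (size (s1 ++ s2)).+1%:R - 1 :> R by rewrite -natr1 addrK.
move: (size s2).+1%:R (size (s1 ++ s2)).+1%:R => k j k1 kj eV' eV /andP[h1 h2].
have j0 : 0 < j by lra.
(* [j] subjects are at risk at [y] without [x], and [j + 1] with it. *)
have key : j * (j + 1) * (V' - V) = W - mark y + j * j * (W' - W).
  have -> : j * (j + 1) * (V' - V) = j * ((j + 1) * V') - (j + 1) * (j * V) by ring.
  by rewrite eV eV'; ring.
have jj0 : 0 < j * (j + 1) by apply: mulr_gt0 => //; lra.
apply/andP; split.
  rewrite -(ler_pM2l jj0).
  have -> : j * (j + 1) * (k * (V' - V)) = k * (j * (j + 1) * (V' - V)) by ring.
  rewrite key.
  have -> : j * (j + 1) * - V = - (j + 1) * (j * V) by ring.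
  rewrite eV.
  have H : 0 <= j * j * (k * (W' - W) + W).
    by apply: mulr_ge0; [apply: mulr_ge0; lra|lra].
  have H2 : 0 <= (k - 1) * W by apply: mulr_ge0; lra.
  have H3 : 0 <= (j + 1 - k) * mark y by apply: mulr_ge0; lra.
  rewrite -subr_ge0.
  have -> : k * (W - mark y + j * j * (W' - W)) - - (j + 1) * (mark y + (j - 1) * W) =
     j * j * (k * (W' - W) + W) + (k - 1) * W + (j + 1 - k) * mark y by ring.
  lra.
rewrite -(ler_pM2l jj0).
have -> : j * (j + 1) * (k * (V' - V)) = k * (j * (j + 1) * (V' - V)) by ring.
rewrite key.
have -> : j * (j + 1) * (1 - V) = (j + 1) * (j - j * V) by ring.
rewrite eV.
have H : 0 <= j * j * ((1 - W) - k * (W' - W)).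
  by apply: mulr_ge0; [apply: mulr_ge0; lra|lra].
have H2 : 0 <= (k - 1) * (1 - W) by apply: mulr_ge0; lra.
have H3 : 0 <= (j + 1 - k) * (1 - mark y) by apply: mulr_ge0; lra.
rewrite -subr_ge0.
have -> : (j + 1) * (j - (mark y + (j - 1) * W)) - k * (W - mark y + j * j * (W' - W)) =
  j * j * ((1 - W) - k * (W' - W)) + (k - 1) * (1 - W) + (j + 1 - k) * (1 - mark y) by ring.
lra.
Qed.

(** Consecutive failures receive the same mass, so their order is irrelevant. *)
Lemma km_rec_failed_front d s1 s x s2 : failed x -> all failed s ->
  km_rec d (s1 ++ s ++ x :: s2) = km_rec d (s1 ++ x :: s ++ s2).
Proof.
move=> fx fs; elim: s1 d => [|y s1 IH] d; last first.
  by rewrite /= !IH; congr (if _ then (_ + _%:R * _) / _%:R else _); rewrite !size_cat/= !size_cat/= addnS.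
rewrite !cat0s; elim: s fs => //= y s IH /andP[fy fs].
rewrite IH//= fx fy !size_cat/= !addnS.
have n1 : (size s + size s2).+1%:R != 0 :> R by rewrite pnatr_eq0.
have n2 : (size s + size s2).+2%:R != 0 :> R by rewrite pnatr_eq0.
by rewrite ![_.+1%:R * (_ / _)]mulrCA !divff// !mulr1; congr (_ / _); ring.
Qed.

End km_integral.

(** * Exchanging one observation *)

Section bounded_differences.
Context (R : realType).
Local Notation pt := (R * bool * R)%type.
Implicit Types (x y : pt) (s t : seq pt).
Local Notation obs_le := (@obs_le R).

Lemma sort_insert x s : exists s1 s2,
  sort obs_le s = s1 ++ s2 /\ sort obs_le (x :: s) = s1 ++ x :: s2.
Proof.
have : x \in sort obs_le (x :: s) by rewrite mem_sort mem_head.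
move=> /splitPr E; move Et : (sort obs_le (x :: s)) E => t E.
case: E Et => s1 s2 Et; exists s1, s2; split => //.
have st : sorted obs_le (s1 ++ x :: s2) by rewrite -Et sort_sorted//; exact: obs_le_total.
apply: (sorted_eq (@obs_le_trans R) (@obs_le_anti R)).
- by apply: sort_sorted; exact: obs_le_total.
- apply: (subseq_sorted (@obs_le_trans R) _ st).
  by apply: cat_subseq => //; exact: subseq_cons.
- have p : perm_eq (s1 ++ x :: s2) (x :: s) by rewrite -Et perm_sort.
  rewrite perm_sort -(perm_cons x) perm_sym; apply: perm_trans p.
  by rewrite perm_sym; apply/permEl/(perm_catCA s1 [:: x]).
Qed.

Variable tau : R.

(** Failure times are at most [tau], so what is still observed at [tau] is a
    failure. *)
Definition valid_obs : pred pt :=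
  fun x => unit_mark x && ((tau <= utime x) ==> failed x).

Definition at_tau s : nat := count (fun x => tau <= utime x) s.

Lemma at_tau_perm s t : perm_eq s t -> at_tau s = at_tau t.
Proof. by move/permP; apply. Qed.

Lemma sorted_split s : sorted obs_le s -> exists s1 s2,
  [/\ s = s1 ++ s2, all (fun x => utime x < tau) s1 & all (fun x => tau <= utime x) s2].
Proof.
elim: s => [|x s IH] /=; first by exists [::], [::].
move=> xs; have [s1 [s2 [es h1 h2]]] := IH (path_sorted xs).
have [xt|tx] := ltP (utime x) tau; first by exists (x :: s1), s2; rewrite /= es xt.
exists [::], (x :: s); split => //; apply/andP; split => //.
have /allP hx := order_path_min (@obs_le_trans R) xs.
apply/allP => y ys; apply: (le_trans tx); apply: obs_le_utime; exact: hx.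
Qed.

Variable mu : R -> R.
Hypothesis mu01 : forall u, 0 <= mu u <= 1.
Variable d : R.
Hypothesis d01 : 0 <= d <= 1.
Local Notation V := (km_int mu d).

Lemma valid_obs_unit s : all valid_obs s -> all (@unit_mark R) s.
Proof. by apply: sub_all => x /andP[]. Qed.

(** The subjects at risk at the time of [x] include those still at risk at
    [tau]; a tie at [tau] is among failures, whose order is irrelevant, so
    that [x] may be placed first. *)
Lemma km_int_insert x s : valid_obs x -> all valid_obs s ->
  - V s <= (at_tau s).+1%:R * (V (x :: s) - V s) <= 1 - V s.
Proof.
move=> vx vs; have /andP[v0 v1] := km_int01 mu01 d01 (valid_obs_unit vs).
suff [k mk /andP[h1 h2]] : exists2 k : R, (at_tau s).+1%:R <= k &
    - V s <= k * (V (x :: s) - V s) <= 1 - V s.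
  have m0 : 0 < (at_tau s).+1%:R :> R by rewrite ltr0n.
  move: (_.+1%:R) m0 mk => m m0 mk; move: h1 h2.
  move: (V (x :: s) - V s) => D h1 h2.
  have [D0|D0] := leP 0 D.
    have : m * D <= k * D by rewrite ler_wpM2r.
    have : 0 <= m * D by rewrite mulr_ge0// ltW.
    by move=> ? ?; apply/andP; split; lra.
  have : k * D <= m * D by rewrite ler_wnM2r// ltW.
  have : m * D <= 0 by rewrite mulr_ge0_le0// ltW.
  by move=> ? ?; apply/andP; split; lra.
have [s1 [s2 [es ex]]] := sort_insert x s.
have vs12 : all valid_obs (s1 ++ s2) by rewrite -es all_sort.
have at12 : at_tau s = at_tau (s1 ++ s2).
  by rewrite -es; apply: at_tau_perm; rewrite perm_sym perm_sort.
have sx : sorted obs_le (s1 ++ x :: s2) by rewrite -ex; apply: sort_sorted; exact: obs_le_total.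
have ss1 : sorted obs_le s1 by have [] := cat_sorted2 sx.
have [l [a [e1 hl ha]]] := sorted_split ss1.
have /andP[vs1 vs2] : all valid_obs s1 && all valid_obs s2 by rewrite -all_cat.
have /andP[vl va] : all valid_obs l && all valid_obs a by rewrite -all_cat -e1.
have fa : all (@failed R) a.
  apply/allP => y ya; have /andP[_ /implyP] := allP va y ya.
  by apply; exact: (allP ha).
have E : km_rec mu d (s1 ++ x :: s2) = km_rec mu d (l ++ x :: a ++ s2).
  rewrite e1 -catA; case: a e1 ha va fa => // y a e1 ha va fa.
  apply: km_rec_failed_front => //.
  have yx : obs_le y x.
    move: sx; rewrite e1 -!catA => /(subseq_sorted (@obs_le_trans R)) => /(_ [:: y; x]).
    rewrite /= andbT; apply; apply: (@subseq_trans _ (y :: a ++ x :: s2)).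
      by rewrite /= eqxx sub1seq mem_cat mem_head orbT.
    exact: suffix_subseq.
  have /andP[_ /implyP] := vx; apply.
  by apply: le_trans (obs_le_utime yx); have /andP[] := ha.
exists (size (a ++ s2)).+1%:R.
  rewrite ler_nat ltnS at12 e1 -catA /at_tau count_cat.
  rewrite (_ : count _ l = 0%N) ?add0n ?count_size//.
  apply/eqP; rewrite -leqn0 leqNgt -has_count -all_predC.
  by apply: sub_all hl => y /=; rewrite ltNge.
have -> : V s = km_rec mu d (l ++ a ++ s2) by rewrite /km_int es e1 catA.
rewrite {1 2}/km_int ex E.
apply: km_rec_insert => //; [exact: valid_obs_unit|by case/andP: vx|].
by apply: valid_obs_unit; rewrite all_cat va.
Qed.

Variable c : R.
Hypothesis c01 : 0 <= c <= 1.

(** For a sample of size [n] this is [n] times the error of the Kaplan--Meier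
    integral, weighted by the fraction of subjects at risk at [tau]. *)
Definition km_dev s : R := (at_tau s)%:R * (V s - c).

Lemma km_dev_perm s t : perm_eq s t -> km_dev s = km_dev t.
Proof. by move=> st; rewrite /km_dev (at_tau_perm st) (km_int_perm _ _ st). Qed.

Lemma km_dev_insert x s (v := V s) : valid_obs x -> all valid_obs s ->
  - Num.max v c <= km_dev (x :: s) - km_dev s <= 1 - Num.min v c.
Proof.
move=> vx vs; have := km_int_insert vx vs; rewrite -/v.
have /andP[v0 v1] := km_int01 mu01 d01 (valid_obs_unit vs); have /andP[c0 c1] := c01.
have M1 : v <= Num.max v c by rewrite le_max lexx.
have M2 : c <= Num.max v c by rewrite le_max lexx orbT.
have m1 : Num.min v c <= v by rewrite ge_min lexx.
have m2 : Num.min v c <= c by rewrite ge_min lexx orbT.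
rewrite /km_dev -/v {1}/at_tau/=; case: (tau <= utime x).
  rewrite add1n -natr1 -/(at_tau s).
  move: (at_tau s)%:R (V (x :: s)) => m v' /andP[h1 h2].
  by apply/andP; split; lra.
rewrite add0n -/(at_tau s) -natr1.
have m0 : 0 <= (at_tau s)%:R :> R by exact: ler0n.
move: (at_tau s)%:R m0 (V (x :: s)) => m m0 v' /andP[h1 h2].
have [D0|D0] := leP 0 (v' - v).
  have : 0 <= m * (v' - v) by rewrite mulr_ge0.
  by move=> ?; apply/andP; split; lra.
have : m * (v' - v) <= 0 by rewrite mulr_ge0_le0// ltW.
by move=> ?; apply/andP; split; lra.
Qed.

(** Both values differ from that without the exchanged observation by
    elements of one interval, of length [1 + |v - c| <= 2]. *)
Lemma km_dev_bounded_diff s1 x y s2 : all valid_obs s1 -> valid_obs x ->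
  valid_obs y -> all valid_obs s2 ->
  `|km_dev (s1 ++ x :: s2) - km_dev (s1 ++ y :: s2)| <= 2.
Proof.
move=> v1 vx vy v2; have vs : all valid_obs (s1 ++ s2) by rewrite all_cat v1.
have front z : km_dev (s1 ++ z :: s2) = km_dev (z :: s1 ++ s2).
  by apply: km_dev_perm; apply/permEl/(perm_catCA s1 [:: z]).
rewrite !front; have := km_dev_insert vx vs; have := km_dev_insert vy vs.
have /andP[w0 w1] := km_int01 mu01 d01 (valid_obs_unit vs); have /andP[c0 c1] := c01.
rewrite ler_norml maxEle minEle; case: ifP => h /andP[h1 h2] /andP[h3 h4].
  by apply/andP; split; lra.
by apply/andP; split; lra.
Qed.

Definition rem_at i s := take i s ++ drop i.+1 s.

(** For each subject at risk at [tau] the integral is taken over the other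
    subjects only, which makes the two factors of each summand independent. *)
Definition km_dev_loo (x0 : pt) s : R :=
  \sum_(i < size s) (tau <= utime (nth x0 s i))%R%:R * (V (rem_at i s) - c).

Lemma perm_rem_at (T : eqType) (x0 : T) (s : seq T) i : (i < size s)%N ->
  perm_eq s (nth x0 s i :: take i s ++ drop i.+1 s).
Proof.
move=> si; rewrite -{1}(cat_take_drop i s) (drop_nth x0)//.
by apply/permEl/(perm_catCA _ [:: _]).
Qed.

(** Each of the [at_tau s] summands changes by at most [1 / at_tau s]. *)
Lemma km_dev_loo_near x0 s : all valid_obs s ->
  `|km_dev s - km_dev_loo x0 s| <= 1.
Proof.
move=> vs; pose b i : R := (tau <= utime (nth x0 s i))%R%:R.
have atE : (at_tau s)%:R = \sum_(i < size s) b i.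
  rewrite /at_tau -sum1_count natr_sum big_mkcond/= (big_nth x0) big_mkord.
  by apply: eq_bigr => i _; rewrite /b; case: (tau <= _).
have [m0|m0] := posnP (at_tau s).
  have z i : (i < size s)%N -> b i = 0.
    move=> si; rewrite /b; case: (boolP (tau <= _)) => // h.
    have : has (fun x => tau <= utime x) s.
      by apply/hasP; exists (nth x0 s i) => //; exact: mem_nth.
    by rewrite has_count -/(at_tau s) m0.
  rewrite /km_dev m0 mul0r /km_dev_loo big1 ?subrr ?normr0// => i _.
  by rewrite -/(b i) z ?mul0r.
rewrite -(@ler_pM2l _ (at_tau s)%:R) ?ltr0n// mulr1.
have mn0 : 0 <= (at_tau s)%:R :> R by exact: ler0n.
have -> : km_dev s - km_dev_loo x0 s = \sum_(i < size s) b i * (V s - V (rem_at i s)).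
  rewrite /km_dev atE mulr_suml -sumrB; apply: eq_bigr => i _.
  by rewrite /b -mulrBr; congr (_ * _); lra.
rewrite -[X in X * _]ger0_norm// -normrM mulr_sumr [leRHS]atE.
apply: (le_trans (ler_norm_sum _ _ _)); apply: ler_sum => i _.
rewrite mulrCA normrM [`|b i|]ger0_norm ?ler0n// /b.
case: (boolP (tau <= _)) => ti; last by rewrite mul0r.
rewrite mul1r; have p := perm_rem_at x0 (ltn_ord i); rewrite -/(rem_at i s) in p.
have /andP[vx vr] : valid_obs (nth x0 s i) && all valid_obs (rem_at i s).
  by have := perm_all valid_obs p; rewrite vs /= => <-.
rewrite (at_tau_perm p) (km_int_perm _ _ p) {1}/at_tau/= ti add1n -/(at_tau _).
have := km_int_insert vx vr.
have /andP[v0 v1] := km_int01 mu01 d01 (valid_obs_unit vr).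
by rewrite ler_norml => /andP[h1 h2]; apply/andP; split; lra.
Qed.

End bounded_differences.

(** * Self-consistency *)

Section self_consistency.
Context (R : realType) (mu : R -> R).
Local Notation pt := (R * bool * R)%type.
Implicit Types (x y : pt) (s t : seq pt).
Local Notation obs_le := (@obs_le R).

(** The censorings tied with [y] come directly after it and only pass their mass
    on, to what is strictly later. *)
Lemma km_rec_later y s : path obs_le y s -> ~~ failed y ->
  km_rec mu (mu (utime y)) [seq z <- s | utime y < utime z] = km_rec mu (mu (utime y)) s.
Proof.
elim: s y => //= z s IH y /andP[yz zs] fy.
case: ltP => h.
  congr (km_rec _ _ (_ :: _)); apply/all_filterP/allP => w ws.
  have /allP/(_ _ ws) zw := order_path_min (@obs_le_trans R) zs.
  exact: lt_le_trans h (obs_le_utime zw).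
have e : utime y = utime z by apply/le_anti; rewrite h (obs_le_utime yz).
have fz : ~~ failed z.
  by move: yz; rewrite /obs_le e ltxx eqxx (negbTE fy)/= => /andP[/eqP<-].
by rewrite (negbTE fz) e; exact: IH.
Qed.

(** The expected mark of [x] when its failure time, if censored, is drawn from the
    Kaplan--Meier estimator on its right. *)
Definition imputed_mark s x : R :=
  if failed x then mark x
  else km_int mu (mu (utime x)) [seq y <- s | utime x < utime y].

Lemma km_rec_self d s : sorted obs_le s ->
  (size s)%:R * km_rec mu d s = \sum_(x <- s) imputed_mark s x.
Proof.
elim: s d => [|y s IH] d; first by rewrite big_nil mul0r.
move=> ys; have ss := path_sorted ys; rewrite big_cons.
have -> : \sum_(x <- s) imputed_mark (y :: s) x = \sum_(x <- s) imputed_mark s x.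
  apply: eq_big_seq => x xs; rewrite /imputed_mark/=.
  have /allP/(_ _ xs) yx := order_path_min (@obs_le_trans R) ys.
  by rewrite ltNge (obs_le_utime yx).
rewrite -(IH (if failed y then d else mu (utime y)))// {1}/imputed_mark.
case: (boolP (failed y)) => fy; first by rewrite km_rec_failed.
rewrite /= (negbTE fy) ltxx -natr1 mulrDl mul1r addrC; congr (_ + _).
rewrite /km_int sorted_sort; [by rewrite km_rec_later|exact: obs_le_trans|].
exact: (sorted_filter (@obs_le_trans R)).
Qed.

(** Self-consistency of the Kaplan--Meier estimator, the source of its
    unbiasedness: the mass that a censored observation leaves to its right is
    spread there like the mass of the sample on its right. *)
Lemma km_int_self d s :
  (size s)%:R * km_int mu d s = \sum_(x <- s) imputed_mark s x.
Proof.
rewrite /km_int -(size_sort obs_le) km_rec_self; last by apply: sort_sorted; exact: obs_le_total.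
have ps : perm_eq (sort obs_le s) s by rewrite perm_sort.
rewrite (perm_big _ ps)/=; apply: eq_bigr => x _; rewrite /imputed_mark.
by case: ifP => // _; apply: km_int_perm; exact: perm_filter.
Qed.

End self_consistency.

(** * Measurability of the Kaplan--Meier integral *)

Section km_int_measurable.
Context (R : realType) (mu : R -> R).
Hypothesis mmu : measurable_fun setT mu.
Local Notation pt := (R * bool * R)%type.
Context (d : measure_display) (Th : measurableType d).
Implicit Types (x y : Th -> pt) (xs : seq (Th -> pt)).

Lemma measurable_utime : measurable_fun setT (@utime R).
Proof. by apply: (measurableT_comp measurable_fst). Qed.

Lemma measurable_failed : measurable_fun setT (@failed R).
Proof. by apply: (measurableT_comp measurable_snd). Qed.

Lemma measurable_mark : measurable_fun setT (@mark R).
Proof. exact: measurable_snd. Qed.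

Let mu_ x : measurable_fun setT x ->
  measurable_fun setT (fun th => utime (x th)).
Proof. by move=> mx; apply: (measurableT_comp measurable_utime). Qed.

Let mf_ x : measurable_fun setT x ->
  measurable_fun setT (fun th => failed (x th)).
Proof. by move=> mx; apply: (measurableT_comp measurable_failed). Qed.

Let mv_ x : measurable_fun setT x ->
  measurable_fun setT (fun th => mark (x th)).
Proof. by move=> mx; apply: (measurableT_comp measurable_mark). Qed.

Lemma measurable_obs_le x y : measurable_fun setT x -> measurable_fun setT y ->
  measurable_fun setT (fun th => obs_le (x th) (y th)).
Proof.
move=> mx my; rewrite /obs_le.
apply: measurable_or; first by apply: measurable_fun_ltr; exact: mu_.
apply: measurable_and; first by apply: measurable_fun_eqr; exact: mu_.
apply: measurable_or; first by apply: measurable_and; [exact: mf_|apply: measurable_neg; exact: mf_].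
apply: measurable_and; last by apply: measurable_fun_ler; exact: mv_.
rewrite (_ : (fun _ => _) = (fun th => if failed (x th) then failed (y th) else ~~ failed (y th))).
  by apply: measurable_fun_ifT; [exact: mf_|exact: mf_|apply: measurable_neg; exact: mf_].
by apply/funext => th; case: (failed (x th)); case: (failed _).
Qed.

Lemma measurable_km_rec (dd : Th -> R) xs : measurable_fun setT dd ->
  all_measurable xs ->
  measurable_fun setT (fun th => km_rec mu (dd th) (eval_seq xs th)).
Proof.
elim: xs dd => //= x xs IH dd mdd [mx mxs].
apply: measurable_fun_ifT; [exact: mf_| |].
  rewrite (_ : (fun _ => _) = (fun th => (mark (x th) + (size xs)%:R * km_rec mu (dd th) (eval_seq xs th)) * (size xs).+1%:R^-1)); last first.
    by apply/funext => th; rewrite size_map.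
  apply: measurable_funM; last exact: measurable_cst.
  apply: measurable_funD; first exact: mv_.
  by apply: measurable_funM; [exact: measurable_cst|exact: IH].
by apply: IH => //; apply: (measurableT_comp mmu); exact: mu_.
Qed.

Let msorted xs : all_measurable xs ->
  measurable_fun setT (fun th => sorted (@obs_le R) (eval_seq xs th)).
Proof.
case: xs => [|x xs]; first by move=> _; exact: measurable_cst.
elim: xs x => [|y xs IH] x /=; first by move=> _; exact: measurable_cst.
move=> [mx [my mxs]]; apply: measurable_and; first exact: measurable_obs_le.
exact: IH.
Qed.

(** On each of the finitely many events on which a given permutation sorts
    the observations, the functional is a measurable expression. *)
Lemma measurable_km_int (dd : Th -> R) xs : measurable_fun setT dd ->
  all_measurable xs ->
  measurable_fun setT (fun th => km_int mu (dd th) (eval_seq xs th)).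
Proof.
move=> mdd mxs _ B mB; rewrite setTI.
pose x0 : Th -> pt := fun=> (0, false, 0).
pose xl (l : seq nat) := [seq nth x0 xs i | i <- l].
have mxl l : all_measurable (xl l).
  elim: l => //= i l IH; split => //; apply: all_measurable_nth => //.
  exact: measurable_cst.
pose L := permutations (iota 0 (size xs)).
rewrite (_ : _ @^-1` _ = \big[setU/set0]_(l <- L)
   ([set th | sorted (@obs_le R) (eval_seq (xl l) th)] `&` [set th | B (km_rec mu (dd th) (eval_seq (xl l) th))])).
  apply: bigsetU_measurable => l _; apply: measurableI.
    by have := @msorted _ (mxl l) measurableT [set true] I; rewrite setTI.
  by have := @measurable_km_rec _ _ mdd (mxl l) measurableT _ mB; rewrite setTI.
rewrite -bigcup_seq; apply/seteqP; split => th /=.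
  move=> Bth; have /perm_iotaP : perm_eq (sort (@obs_le R) (eval_seq xs th)) (eval_seq xs th) by rewrite perm_sort.
  move=> /(_ (x0 th))[l pl el]; rewrite size_map in pl.
  have E : sort (@obs_le R) (eval_seq xs th) = eval_seq (xl l) th.
    rewrite el /xl /eval_seq -map_comp; apply/eq_in_map => i il /=.
    rewrite (nth_map x0)//; have := perm_mem pl i; rewrite il mem_iota add0n.
    by move=> /esym/andP[].
  exists l; first by rewrite /= mem_permutations.
  have so : sorted (@obs_le R) (eval_seq (xl l) th) by rewrite -E sort_sorted//; exact: obs_le_total.
  by move: Bth; rewrite /km_int E.
move=> [l]; rewrite /= mem_permutations => pl [sl Bl].
rewrite /km_int (_ : sort _ _ = eval_seq (xl l) th)//.
apply: (sorted_eq (@obs_le_trans R) (@obs_le_anti R)) => //.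
  by apply: sort_sorted; exact: obs_le_total.
rewrite perm_sort perm_sym; apply/(perm_iotaP (x0 th)); exists l; first by rewrite size_map.
rewrite /xl /eval_seq -map_comp; apply/eq_in_map => i il /=.
rewrite (nth_map x0)//; have := perm_mem pl i; rewrite il mem_iota add0n.
by move=> /esym/andP[].
Qed.

End km_int_measurable.

Section km_dev_measurable.
Context (R : realType) (mu : R -> R) (tau d c : R).
Hypothesis mmu : measurable_fun setT mu.

Lemma seq_measurable_at_tau : seq_measurable (fun s => (at_tau tau s)%:R : R).
Proof.
move=> d' Th; elim=> [_|x xs IH [mx mxs]] /=; first exact: measurable_cst.
pose b th : R := (tau <= utime (x th))%R%:R.
rewrite (_ : (fun _ => _) = (fun th => b th + (at_tau tau (eval_seq xs th))%:R)); last first.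
  by apply/funext => th; rewrite -natrD.
apply: measurable_funD; last exact: IH.
have [] // : bmeasurable b.
apply: bmeasurable_bool; apply: measurable_fun_ler; first exact: measurable_cst.
exact: (measurableT_comp (@measurable_utime R)).
Qed.

Lemma seq_measurable_km_dev : seq_measurable (km_dev tau mu d c).
Proof.
move=> d' Th xs mxs; apply: measurable_funM; first exact: seq_measurable_at_tau.
apply: measurable_funB; last exact: measurable_cst.
by apply: measurable_km_int => //; exact: measurable_cst.
Qed.

End km_dev_measurable.

(** * Unbiasedness and deviations of the Kaplan--Meier integral *)

Section unbiasedness.
Context (R : realType) (dO : measure_display) (Om : measurableType dO).
Variable P : probability Om R.
Local Notation pt := (R * bool * R)%type.
Variables (X : Om -> pt) (mu : R -> R).
Hypothesis mX : measurable_fun setT X.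
Hypothesis mmu : measurable_fun setT mu.
Hypothesis mu01 : forall u, 0 <= mu u <= 1.
Hypothesis unitX : forall w, unit_mark (X w).

Definition after (u : R) (w : Om) : bool := u < utime (X w).

Lemma measurable_after (d : measure_display) (Th : measurableType d)
    (u : Th -> R) (x : Th -> Om) :
  measurable_fun setT u -> measurable_fun setT x ->
  measurable_fun setT (fun th => after (u th) (x th)).
Proof.
move=> mu_ mx; apply: measurable_fun_ltr => //.
apply: (measurableT_comp (@measurable_utime R)).
exact: measurableT_comp.
Qed.

Lemma measurable_all (d : measure_display) (Th : measurableType d)
    (u : Th -> R) (xs : seq (Th -> Om)) :
  measurable_fun setT u -> all_measurable xs ->
  measurable_fun setT (fun th => all (after (u th)) (eval_seq xs th)).
Proof.
move=> mu_; elim: xs => [_|x xs IH [mx mxs]] /=; first exact: measurable_cst.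
by apply: measurable_and; [exact: measurable_after|exact: IH].
Qed.

Lemma measurable_km_int_filter (d : measure_display) (Th : measurableType d)
    (u dd : Th -> R) (ys xs : seq (Th -> Om)) :
  measurable_fun setT u -> measurable_fun setT dd -> all_measurable ys -> all_measurable xs ->
  measurable_fun setT (fun th =>
    km_int mu (dd th) [seq X w | w <- eval_seq ys th ++ [seq w <- eval_seq xs th | after (u th) w]]).
Proof.
move=> mu_ md; elim: xs ys => [|x xs IH] ys mys /=.
  move=> _; have := measurable_km_int mmu md (all_measurable_map mX mys).
  by congr measurable_fun; apply/funext => th; rewrite cats0 /eval_seq -!map_comp.
move=> [mx mxs].
rewrite (_ : (fun _ => _) = (fun th => if after (u th) (x th)
  then km_int mu (dd th) [seq X w | w <- eval_seq (rcons ys x) th ++ [seq w <- eval_seq xs th | after (u th) w]]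
  else km_int mu (dd th) [seq X w | w <- eval_seq ys th ++ [seq w <- eval_seq xs th | after (u th) w]])); last first.
  by apply/funext => th; case: ifP => // _; rewrite /eval_seq map_rcons cat_rcons.
apply: measurable_fun_ifT; [exact: measurable_after| |exact: IH].
by apply: IH => //; rewrite -cats1 all_measurable_cat.
Qed.

Lemma all_unitX s : all (@unit_mark R) [seq X w | w <- s].
Proof. by rewrite all_map; apply/allP => w _ /=. Qed.

Lemma km_intX01 d s : 0 <= d <= 1 -> 0 <= km_int mu d [seq X w | w <- s] <= 1.
Proof. by move=> d01; apply: km_int01 => //; exact: all_unitX. Qed.

Lemma seq_bmeasurable_all u :
  seq_bmeasurable (fun s => (all (after u) s)%:R : R).
Proof.
by apply: seq_bmeasurable_bool => d Th xs mxs; apply: measurable_all => //; exact: measurable_cst.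
Qed.

Lemma seq_bmeasurable_km_int_filter u d : 0 <= d <= 1 ->
  seq_bmeasurable (fun s => km_int mu d [seq X w | w <- [seq w <- s | after u w]]).
Proof.
move=> d01; split=> [d' Th xs mxs|n].
  by apply: (@measurable_km_int_filter _ _ (fun=> u) (fun=> d) [::]) => //; exact: measurable_cst.
by exists 1 => s _; have /andP[h1 h2] := km_intX01 [seq w <- s | after u w] d01; rewrite ger0_norm.
Qed.

Lemma seq_bmeasurable_km_int d : 0 <= d <= 1 ->
  seq_bmeasurable (fun s => km_int mu d [seq X w | w <- s]).
Proof.
move=> d01; split=> [d' Th xs mxs|n].
  have := @measurable_km_int_filter _ _ (fun=> 0) (fun=> d) xs [::].
  move=> /(_ (measurable_cst _) (measurable_cst _) mxs I).
  by congr measurable_fun; apply/funext => th; rewrite /= cats0.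
by exists 1 => s _; have /andP[h1 h2] := km_intX01 s d01; rewrite ger0_norm.
Qed.

Definition prob_after (u : R) : R := \int[P]_w (after u w)%:R.
Local Notation p := prob_after.

Lemma bmeasurable_after u : bmeasurable (fun w => (after u w)%:R : R).
Proof.
apply: bmeasurable_bool; apply: measurable_after; first exact: measurable_cst.
exact: measurable_id.
Qed.

Lemma iid_mean_all u n : iid_mean P n (fun s => (all (after u) s)%:R)
  = p u ^+ n.
Proof.
elim: n => //= n IH.
rewrite (Ex_eq P (g := fun w => (after u w)%:R * p u ^+ n)); last first.
  move=> w; rewrite -IH -iid_meanZl; last exact: seq_bmeasurable_all.
  by apply: iid_mean_eq => s _ /=; rewrite -natrM mulnb.
by rewrite ExZr ?exprS//; exact: bmeasurable_after.
Qed.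

(** Given their number, the points after [u] of a sample that lies after [u0] are
    a sample from the law conditioned on lying after [u]. The proof moves the
    points one at a time from a group subject to [u0] to a group subject to [u]. *)
Lemma iid_mean_filter (u0 u : R) (K : nat) : u0 <= u ->
  (forall k, (k <= K)%N -> iid_mean P k (fun s => (all (after u) s)%:R *
     km_int mu (mu u) [seq X w | w <- s]) = p u ^+ k * mu u) ->
  forall k, (k <= K)%N -> iid_mean P k (fun s => (all (after u0) s)%:R *
     km_int mu (mu u) [seq X w | w <- [seq w <- s | after u w]]) = p u0 ^+ k * mu u.
Proof.
move=> u0u HK.
have sub w : after u w -> after u0 w by exact: le_lt_trans.
pose F s := (all (after u0) s)%:R * km_int mu (mu u) [seq X w | w <- [seq w <- s | after u w]].
have bF : seq_bmeasurable F by apply: seq_bmeasurableM; [exact: seq_bmeasurable_all|exact: seq_bmeasurable_km_int_filter].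
suff H j i : (i + j <= K)%N ->
    iid_mean P i (fun s1 => (all (after u) s1)%:R * iid_mean P j (fun s2 => F (s1 ++ s2))) =
    p u ^+ i * p u0 ^+ j * mu u.
  by move=> k kK; have := H k 0%N kK; rewrite /= !mul1r.
elim: j i => [|j IH] i ijK.
  rewrite mulr1 -HK; last by rewrite -[i]addn0.
  apply: iid_mean_eq => s _; rewrite /= cats0 /F.
  case: (boolP (all _ s)) => h; last by rewrite !mul0r.
  by rewrite (sub_all sub h) mul1r (all_filterP h).
pose A s := iid_mean P j (fun s2 => F (s ++ s2)).
have bA : seq_bmeasurable A by exact: seq_bmeasurable_iid_mean.
pose G s := (all (after u) s)%:R * A s.
have bG : seq_bmeasurable G by apply: seq_bmeasurableM => //; exact: seq_bmeasurable_all.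
have bG1 : seq_bmeasurable (fun s => \int[P]_w G (rcons s w)).
  have := seq_bmeasurable_iid_mean P 1 bG; congr seq_bmeasurable; apply/funext => s /=.
  by apply: Ex_eq => w; rewrite cats1.
have step s : (all (after u) s)%:R * iid_mean P j.+1 (fun s2 => F (s ++ s2)) =
    \int[P]_w G (rcons s w) + (p u0 - p u) * G s.
  have bA1 : bmeasurable (fun w => A (rcons s w)).
    have := bmeasurable_iid_mean P 0 (seq_bmeasurable_cat s bA); congr bmeasurable; apply/funext => w /=.
    by rewrite cats1.
  rewrite /= (Ex_eq P (g := fun w => (after u w)%:R * A (rcons s w) +
       ((after u0 w)%:R - (after u w)%:R) * A s)); last first.
    move=> w; have E : iid_mean P j (fun s2 => F (s ++ w :: s2)) = A (rcons s w).
      by apply: iid_mean_eq => s2 _; rewrite cat_rcons.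
    rewrite E; case: (boolP (after u w)) => uw.
      by rewrite (sub _ uw) subrr mul0r addr0 mul1r.
    rewrite mul0r add0r subr0 /A -iid_meanZl; last exact: seq_bmeasurable_cat.
    apply: iid_mean_eq => s2 _; rewrite /F cat_rcons !filter_cat/= (negbTE uw).
    rewrite mulrA -natrM mulnb !all_cat/=; congr ((nat_of_bool _)%:R * _).
    by case: (all _ s); case: (after u0 w).
  have ba := bmeasurable_after.
  rewrite ExD; [|by apply: bmeasurableM|by apply: bmeasurableM; [exact: bmeasurableB|exact: bmeasurable_cst]].
  rewrite ExZr; last exact: bmeasurableB.
  rewrite ExB// mulrDr -/(p u0) -/(p u); congr (_ + _); last by rewrite mulrCA.
  rewrite -ExZl; last exact: bmeasurableM.
  by apply: Ex_eq => w; rewrite /G all_rcons mulrA -natrM mulnb andbC.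
transitivity (iid_mean P i (fun s => \int[P]_w G (rcons s w) + (p u0 - p u) * G s)).
  by apply: iid_mean_eq => s _; exact: step.
rewrite iid_meanD//; last by apply: seq_bmeasurableM => //; exact: seq_bmeasurable_cst.
have ij1 : (i.+1 + j <= K)%N by rewrite addSnnS.
have ij : (i + j <= K)%N by apply: leq_trans ijK; rewrite leq_add2l.
rewrite iid_meanZl// -iid_mean_rcons (IH _ ij1) (IH _ ij).
by rewrite !exprS; ring.
Qed.

(* Replacing the mark of a censored observation by [mu] preserves the mean. *)
Hypothesis imputation : forall u,
  \int[P]_w ((after u w)%:R *
     (if failed (X w) then mark (X w) else mu (utime (X w)))) = p u * mu u.

(** Unbiasedness given that the sample lies after [u], by induction on its size.
    By self-consistency and symmetry, the mean is that of the mark imputed to the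
    first observation. If this is censored, the points on its right form a
    smaller sample, with mean [mu] at the time of censoring; the hypothesis on
    one observation concludes. *)
Lemma iid_mean_km_int n u : iid_mean P n (fun s => (all (after u) s)%:R *
     km_int mu (mu u) [seq X w | w <- s]) = p u ^+ n * mu u.
Proof.
elim/ltn_ind: n u => -[|n] IH u; first by rewrite /= !mul1r.
pose val w t := if failed (X w) then mark (X w) else
   km_int mu (mu (utime (X w))) [seq X v | v <- [seq v <- t | after (utime (X w)) v]].
pose G s := if s is w :: t then (all (after u) s)%:R * val w t else 0.
have bval w t : `|val w t| <= 1.
  rewrite /val; case: ifP => _.
    by have /andP[h1 h2] := unitX w; rewrite ger0_norm.
  have /andP[h1 h2] := km_intX01 [seq v <- t | after (utime (X w)) v] (mu01 (utime (X w))).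
  by rewrite ger0_norm.
have bG : seq_bmeasurable G.
  split=> [d Th [|x xs] mxs|k]; first exact: measurable_cst.
    have [mx mxs'] := mxs.
    have mXx : measurable_fun setT (X \o x) by exact: measurableT_comp.
    have mUx : measurable_fun setT (fun th => utime (X (x th))).
      exact: (measurableT_comp (@measurable_utime R) mXx).
    apply: measurable_funM.
      by have [] := @bmeasurable_bool R _ _ _ (@measurable_all _ _ (fun=> u) _ (measurable_cst _) mxs).
    apply: measurable_fun_ifT.
    - exact: (measurableT_comp (@measurable_failed R) mXx).
    - exact: (measurableT_comp (@measurable_mark R) mXx).
    - apply: (@measurable_km_int_filter _ _ _ _ [::]) => //.
      exact: (measurableT_comp mmu).
  exists 1 => -[|w t] _ /=; first by rewrite normr0.
  rewrite normrM -[leRHS]mul1r ler_pM//.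
  by case: (_ && _); rewrite ?normr1 ?normr0.
have n0 : n.+1%:R != 0 :> R by rewrite pnatr_eq0.
transitivity (iid_mean P n.+1 G).
  apply: (mulfI n0); rewrite -iid_meanZl; last first.
    by apply: seq_bmeasurableM; [exact: seq_bmeasurable_all|exact: seq_bmeasurable_km_int].
  transitivity (iid_mean P n.+1 (fun s => \sum_(i < n.+1) G (nth point s i :: take i s ++ drop i.+1 s))).
    apply: iid_mean_eq => s sn.
    have E := km_int_self mu (mu u) [seq X w | w <- s]; rewrite size_map sn in E.
    rewrite mulrCA E big_map mulr_sumr (big_nth point) sn big_mkord.
    apply: eq_bigr => i _; have si : (i < size s)%N by rewrite sn.
    have pi := perm_rem_at point si.
    rewrite (perm_all _ pi) /=; congr (_ * _).
    rewrite /imputed_mark /val; case: ifP => // _.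
    apply: km_int_perm; rewrite filter_map perm_map//.
    have := perm_filter (after (utime (X (nth point s i)))) pi.
    by rewrite /= {2}/after ltxx.
  rewrite iid_mean_sum; last by move=> i; exact: seq_bmeasurable_rem.
  rewrite (eq_bigr (fun=> iid_mean P n.+1 G)); last first.
    by move=> i _; rewrite iid_mean_nth// -ltnS.
  by rewrite sumr_const card_ord mulr_natl.
rewrite /= (Ex_eq P (g := fun w => (after u w)%:R *
   (if failed (X w) then mark (X w) else mu (utime (X w))) * p u ^+ n)); last first.
  move=> w; case: (boolP (after u w)) => uw; last first.
    by rewrite !mul0r -[RHS](iid_mean_cst P n); apply: iid_mean_eq => s _; rewrite mul0r.
  rewrite mul1r /val; case: ifP => fw.
    rewrite -iid_mean_all -iid_meanZl; last exact: seq_bmeasurable_all.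
    by apply: iid_mean_eq => s _ /=; rewrite mulrC.
  by rewrite (@iid_mean_filter u (utime (X w)) n) ?(ltW uw)// => [|k kn]; rewrite ?IH// mulrC.
rewrite ExZr; first by rewrite imputation exprS mulrAC.
apply: bmeasurableM; first exact: bmeasurable_after.
split.
  apply: measurable_fun_ifT.
  - exact: (measurableT_comp (@measurable_failed R)).
  - exact: (measurableT_comp (@measurable_mark R)).
  - apply: (measurableT_comp mmu).
    exact: (measurableT_comp (@measurable_utime R)).
by exists 1 => w; have := bval w [::]; rewrite /val /= /km_int.
Qed.

(** The previous lemma, for a condition that always holds. *)
Lemma iid_mean_km_int_mean n u0 : (forall w, u0 < utime (X w)) ->
  iid_mean P n (fun s => km_int mu (mu u0) [seq X w | w <- s]) = mu u0.
Proof.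
move=> hu; have p1 : p u0 = 1.
  rewrite /prob_after (Ex_eq P (g := fun=> 1)) ?Ex_cst// => w.
  by rewrite /after hu.
have := iid_mean_km_int n u0; rewrite p1 expr1n mul1r => E; rewrite -[RHS]E.
apply: iid_mean_eq => s _; have -> : all (after u0) s by apply/allP => w _; exact: hu.
by rewrite mul1r.
Qed.

Variable tau u0 : R.
Hypothesis validX : forall w, valid_obs tau (X w).
Hypothesis afterX : forall w, u0 < utime (X w).
Local Notation c := (mu u0).

Let devX s := km_dev tau mu c c [seq X w | w <- s].

Lemma seq_bmeasurable_at_tau :
  seq_bmeasurable (fun s => (at_tau tau [seq X w | w <- s])%:R : R).
Proof.
split=> [d Th xs mxs|n].
  have := @seq_measurable_at_tau R tau _ _ _ (all_measurable_map mX mxs).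
  by congr measurable_fun; apply/funext => th; rewrite /eval_seq -!map_comp.
by exists n%:R => s <-; rewrite ger0_norm// ler_nat -(size_map X) count_size.
Qed.

Lemma seq_bmeasurable_km_dev : seq_bmeasurable devX.
Proof.
apply: seq_bmeasurableM; first exact: seq_bmeasurable_at_tau.
by apply: seq_bmeasurableB; [exact: seq_bmeasurable_km_int|exact: seq_bmeasurable_cst].
Qed.

Lemma all_validX s : all (valid_obs tau) [seq X w | w <- s].
Proof. by rewrite all_map; apply/allP => w _ /=. Qed.

Lemma bounded_diff_km_dev n : bounded_diff n 2 devX.
Proof.
move=> s1 x y s2 _; rewrite /devX !map_cat /=.
by apply: km_dev_bounded_diff => //; exact: all_validX.
Qed.

(** Leaving out, for each subject at risk at [tau], that subject turns the
    deviation into a sum of products of independent factors, one of them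
    centered; the change is at most 1. *)
Lemma iid_mean_km_dev n : `|iid_mean P n devX| <= 1.
Proof.
pose G s : R := if s is w :: t then
  (tau <= utime (X w))%R%:R * (km_int mu c [seq X w | w <- t] - c) else 0.
have bG : seq_bmeasurable G.
  split=> [d Th [|x xs] mxs|k]; first exact: measurable_cst.
    have [mx mxs'] := mxs; apply: measurable_funM.
      have [] // := @bmeasurable_bool R _ _ (fun th => tau <= utime (X (x th))).
      apply: measurable_fun_ler; first exact: measurable_cst.
      apply: (measurableT_comp (@measurable_utime R)).
      exact: measurableT_comp.
    apply: measurable_funB; last exact: measurable_cst.
    by have [+ _] := seq_bmeasurable_km_int (mu01 u0); apply.
  exists 1 => -[|w t] _ /=; first by rewrite normr0.
  have /andP[h1 h2] := km_intX01 t (mu01 u0); have /andP[h3 h4] := mu01 u0.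
  rewrite normrM -[leRHS]mul1r ler_pM//.
    by case: (tau <= _); rewrite ?normr1 ?normr0.
  by rewrite ler_norml; apply/andP; split; lra.
have bL : seq_bmeasurable (fun s => \sum_(i < n) G (nth point s i :: take i s ++ drop i.+1 s)).
  by apply: seq_bmeasurable_sum => i; exact: seq_bmeasurable_rem.
have L0 : iid_mean P n (fun s => \sum_(i < n) G (nth point s i :: take i s ++ drop i.+1 s)) = 0.
  rewrite iid_mean_sum; last by move=> i; exact: seq_bmeasurable_rem.
  apply: big1 => i _; case: n i {bL} => [[]//|n] i.
  rewrite iid_mean_nth//; last by rewrite -ltnS.
  rewrite /= (Ex_eq P (g := fun=> 0)) ?Ex_cst// => w.
  rewrite iid_meanZl; last by apply: seq_bmeasurableB; [exact: seq_bmeasurable_km_int|exact: seq_bmeasurable_cst].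
  rewrite iid_meanB; [|exact: seq_bmeasurable_km_int|exact: seq_bmeasurable_cst].
  by rewrite iid_mean_cst iid_mean_km_int_mean// subrr mulr0.
rewrite -[iid_mean P n devX]subr0 -L0 -iid_meanB//; last exact: seq_bmeasurable_km_dev.
apply: iid_mean_norm_le => [|s sn]; first by apply: seq_bmeasurableB => //; exact: seq_bmeasurable_km_dev.
have := km_dev_loo_near mu01 (mu01 u0) c (X point) (all_validX s).
rewrite /km_dev_loo size_map sn; congr (`|_ - _| <= _); apply: eq_bigr => i _.
by rewrite /= (nth_map point) ?sn// /rem_at -map_take -map_drop -map_cat.
Qed.

(** The mean being at most 1 in absolute value, on this event the deviation or its
    opposite exceeds its mean by [t]. *)
Lemma km_dev_tail n (l t : R) : 0 <= l -> l * 2 <= 1/3 ->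
  iid_mean P n (fun s => (1 + t <= `|devX s|)%R%:R) <=
  2 * expR (n%:R * (l * 2) ^+ 2 - l * t).
Proof.
move=> l0 l2; have bd := seq_bmeasurable_km_dev; have bnd := seq_bmeasurableN seq_bmeasurable_km_dev.
have bdn : bounded_diff n 2 (fun s => - devX s).
  by move=> s1 x y s2 sn; rewrite -opprD normrN; exact: bounded_diff_km_dev.
have H1 := iid_mean_tail P t bd (@bounded_diff_km_dev n) l0 l2.
have H2 := iid_mean_tail P t bnd bdn l0 l2.
have sbt f : seq_bmeasurable f -> seq_bmeasurable (fun s => (t <= f s - iid_mean P n f)%R%:R).
  move=> bf; apply: seq_bmeasurable_bool; apply: seq_measurable_ler; first exact: seq_bmeasurable_cst.
  by apply: seq_bmeasurableB => //; exact: seq_bmeasurable_cst.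
rewrite -[2]/(1 + 1) mulrDl mul1r; apply: (le_trans _ (lerD H1 H2)).
rewrite -iid_meanD; [|exact: sbt..].
have := iid_mean_km_dev n; rewrite ler_norml => /andP[h1 h2].
apply: le_iid_mean.
- apply: seq_bmeasurable_bool => d Th xs mxs; apply: measurable_fun_ler; first exact: measurable_cst.
  apply: measurableT_comp => //.
  by have [+ _] := bd; apply.
- by apply: seq_bmeasurableD; exact: sbt.
move=> s _; rewrite iid_meanN//.
case: (lerP (1 + t)) => // h; last by rewrite addr_ge0.
have [d0|d0] := leP 0 (devX s).
  rewrite ger0_norm// in h; rewrite (_ : t <= devX s - _ = true) ?lerDl//.
  by apply: le_trans (_ : t <= devX s - 1) _; lra.
rewrite ltr0_norm// in h; rewrite (_ : t <= - devX s - _ = true) ?lerDr//.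
by apply: le_trans (_ : t <= - devX s - 1) _; lra.
Qed.


End unbiasedness.

(** * Inverse-probability-of-censoring weights *)

Section kaplan_meier.
Context (R : realType).
Local Notation pt := (R * bool * R)%type.
Implicit Types (x y : pt) (s t : seq pt).
Local Notation obs_le := (@obs_le R).

Definition km_factor s (v : R) : R :=
  1 - (count (fun x => (utime x == v) && ~~ failed x) s)%:R /
      (count (fun x => v <= utime x) s)%:R.

(** The left limit at [t] of the Kaplan--Meier estimator for the censoring
    times. *)
Definition km_left s (t : R) : R :=
  \prod_(v <- undup [seq utime x | x <- s] | v < t) km_factor s v.

Lemma km_factor_perm s t : perm_eq s t -> km_factor s =1 km_factor t.
Proof. by move=> /permP st v; rewrite /km_factor !st. Qed.

Lemma km_left_perm s t : perm_eq s t -> km_left s =1 km_left t.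
Proof.
move=> st v; rewrite /km_left (perm_big (undup [seq utime x | x <- t])).
  by apply: eq_bigr => w _; exact: km_factor_perm.
apply: uniq_perm; rewrite ?undup_uniq// => w.
by rewrite !mem_undup; apply: perm_mem; exact: perm_map.
Qed.

Lemma km_factor01 s v : 0 <= km_factor s v <= 1.
Proof.
rewrite /km_factor; set c := count _ s; set r := count _ s.
have cr : (c <= r)%N by apply: sub_count => x /= /andP[/eqP->].
have [r0|r0] := posnP r; first by rewrite r0 invr0 mulr0 subr0 ler01 lexx.
have h0 : 0 <= c%:R / r%:R :> R by rewrite divr_ge0.
have h1 : c%:R / r%:R <= 1 :> R by rewrite ler_pdivrMr ?ltr0n// mul1r ler_nat.
by apply/andP; split; lra.
Qed.

Lemma km_left01 s (t : R) : 0 <= km_left s t <= 1.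
Proof.
rewrite /km_left; elim/big_ind : _ => [|a b /andP[a0 a1] /andP[b0 b1]|v _].
- by rewrite ler01 lexx.
- by rewrite mulr_ge0//= mulr_ile1.
- exact: km_factor01.
Qed.

(** Times that were not observed contribute trivial factors. *)
Lemma km_left_sup s (E : seq R) (t : R) : uniq E ->
  {subset [seq utime x | x <- s] <= E} ->
  km_left s t = \prod_(v <- E | v < t) km_factor s v.
Proof.
move=> uE sE; rewrite [RHS](bigID (mem [seq utime x | x <- s]))/=.
rewrite [X in _ * X]big1 ?mulr1; last first.
  move=> v /andP[_ vs]; rewrite /km_factor (_ : count _ s = 0%N) ?mul0r ?subr0//.
  apply/eqP; rewrite -leqn0 leqNgt -has_count; apply: contra vs => /hasP[x xs /andP[/eqP<- _]].
  exact: map_f.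
rewrite -big_filter_cond /km_left -big_filter -[RHS]big_filter.
apply: perm_big; apply: uniq_perm; rewrite ?filter_uniq ?undup_uniq// => v.
rewrite !mem_filter mem_undup; case: (v < t); rewrite /= ?andbF//.
by have [vs|vs] := boolP (v \in [seq utime x | x <- s]); rewrite ?(sE _ vs)// andbF.
Qed.

Definition no_ties s := forall x y, x \in s -> y \in s ->
  failed x -> ~~ failed y -> utime x != utime y.

Section first_observation.
Variables (x : pt) (s : seq pt).
Hypothesis xs : path obs_le x s.
Hypothesis nt : no_ties (x :: s).

Let minx v : v \in undup [seq utime y | y <- x :: s] -> utime x <= v.
Proof.
rewrite mem_undup => /mapP[y]; rewrite inE => /predU1P[->->//|ys ->].
by have /allP/(_ _ ys)/obs_le_utime := order_path_min (@obs_le_trans R) xs.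
Qed.

Lemma km_left_first : km_left (x :: s) (utime x) = 1.
Proof.
rewrite /km_left big_seq_cond big1// => v /andP[/minx h].
by rewrite ltNge h.
Qed.

Let sub : {subset [seq utime y | y <- s] <= undup [seq utime y | y <- x :: s]}.
Proof. by move=> v vs; rewrite mem_undup inE vs orbT. Qed.

Let factor_later v : utime x < v -> km_factor (x :: s) v = km_factor s v.
Proof.
by move=> xv; rewrite /km_factor /= (lt_eqF xv) leNgt xv.
Qed.

(** A failure counts as at risk only up to its own time; if it comes first and
    there are no ties, nobody is censored by then. *)
Lemma km_left_failed (t : R) : failed x -> km_left (x :: s) t = km_left s t.
Proof.
move=> fx; rewrite (km_left_sup _ (undup_uniq _) sub) /km_left.
rewrite big_seq_cond [RHS]big_seq_cond; apply: eq_bigr => v /andP[/minx vx _].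
have [xv|vx'] := ltP (utime x) v; first exact: factor_later.
have e : v = utime x by apply/le_anti; rewrite vx vx'.
rewrite /km_factor /= fx andbF add0n e.
rewrite (_ : count _ s = 0%N) ?mul0r//.
apply/eqP; rewrite -leqn0 leqNgt -has_count; apply/negP => /hasP[y ys /andP[/eqP yx fy]].
have ys' : y \in x :: s by rewrite inE ys orbT.
by have := nt (mem_head _ _) ys' fx fy; rewrite yx eqxx.
Qed.

(** With [c] censorings and [r] subjects at risk besides [x], the factors at
    [utime x] with and without [x] are [1 - (c + 1) / (r + 1)] and [1 - c / r],
    of ratio [r / (r + 1)]. *)
Lemma km_left_censored (t : R) : s != [::] -> ~~ failed x -> utime x < t ->
  km_left (x :: s) t = (size s)%:R / (size s).+1%:R * km_left s t.
Proof.
move=> s0 fx xt; rewrite (km_left_sup _ (undup_uniq _) sub) /km_left.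
have ux : utime x \in undup [seq utime y | y <- x :: s] by rewrite mem_undup mem_head.
rewrite big_mkcond [X in _ = _ * X]big_mkcond.
have uE := undup_uniq [seq utime y | y <- x :: s].
rewrite (bigD1_seq (utime x))//; rewrite [in RHS](bigD1_seq (utime x))// xt.
rewrite mulrA; congr (_ * _); last first.
  rewrite big_seq_cond [RHS]big_seq_cond; apply: eq_bigr => v /andP[/minx vx vx'].
  case: ifP => // _; apply: factor_later; by rewrite lt_neqAle eq_sym vx'.
have cs : count (fun y => utime x <= utime y) s = size s.
  apply/eqP; rewrite -all_count; apply/allP => y ys.
  by have /allP/(_ _ ys)/obs_le_utime := order_path_min (@obs_le_trans R) xs.
rewrite /km_factor /= eqxx fx lexx cs !add1n.
have n0 : (size s)%:R != 0 :> R by rewrite pnatr_eq0 size_eq0.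
have n1 : 1 + (size s)%:R != 0 :> R by rewrite addrC natr1 pnatr_eq0.
rewrite -[(count _ s).+1%:R]natr1 -[(size s).+1%:R]natr1.
by field; rewrite n0 addrC n1.
Qed.

End first_observation.

Variable mu : R -> R.
Variable tau : R.

(** The sum of the marks of the failures, weighted by the inverse of the
    Kaplan--Meier estimator for the censoring times, obeys the recursion that
    defines the Kaplan--Meier integral. *)
Lemma ipcw_sorted d s : sorted obs_le s -> no_ties s -> all (valid_obs tau) s ->
  (s != [::] -> (0 < at_tau tau s)%N) ->
  \sum_(x <- s) (failed x)%:R * mark x / km_left s (utime x) =
  (size s)%:R * km_rec mu d s.
Proof.
elim: s d => [|x s IH] d; first by rewrite big_nil mul0r.
move=> xs nt /andP[vx vs] at0; rewrite big_cons.
have ss := path_sorted xs.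
have nts : no_ties s by move=> y z ys zs; apply: nt; rewrite inE ?ys ?zs orbT.
have at0s : s != [::] -> (0 < at_tau tau s)%N.
  move=> s0; have := at0 isT; rewrite /at_tau/=; case: ltP => // h _.
  case: s s0 xs {IH at0 vs nt ss nts} => // y s _ /andP[xy _].
  by rewrite /= (le_trans h (obs_le_utime xy)).
case: (boolP (failed x)) => fx.
  rewrite km_left_first// divr1 mul1r km_rec_failed// -(IH d)//.
  by congr (_ + _); apply: eq_bigr => y _; rewrite km_left_failed.
rewrite !mul0r add0r /= (negbTE fx).
have s0 : s != [::].
  apply/eqP => s0; have := at0 isT; rewrite s0 /at_tau /= addn0.
  have /andP[_ /implyP h] := vx; rewrite lt0b => /h.
  by rewrite (negbTE fx).
have n0 : (size s)%:R != 0 :> R by rewrite pnatr_eq0 size_eq0.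
have n1 : (size s).+1%:R != 0 :> R by rewrite pnatr_eq0.
rewrite -[km_rec _ _ s](mulKf n0) -(IH (mu (utime x)))// mulrA mulr_sumr.
rewrite big_seq [RHS]big_seq; apply: eq_bigr => y ys.
case: (boolP (failed y)) => fy; last by rewrite !mul0r mulr0.
have xy : utime x < utime y.
  have /allP/(_ _ ys)/obs_le_utime := order_path_min (@obs_le_trans R) xs.
  rewrite le_eqVlt => /orP[/eqP e|//].
  have ys' : y \in x :: s by rewrite inE ys orbT.
  by have := nt _ _ ys' (mem_head _ _) fy fx; rewrite e eqxx.
rewrite km_left_censored// !invfM invrK; ring.
Qed.

Lemma ipcw_km_int d s : no_ties s -> all (valid_obs tau) s ->
  (0 < at_tau tau s)%N ->
  \sum_(x <- s) (failed x)%:R * mark x / km_left s (utime x) =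
  (size s)%:R * km_int mu d s.
Proof.
move=> nt vs at0; have ps : perm_eq (sort obs_le s) s by rewrite perm_sort.
rewrite /km_int -(size_sort obs_le) -ipcw_sorted.
- rewrite (perm_big _ ps)/=; apply: eq_bigr => x _.
  by rewrite (km_left_perm ps).
- by apply: sort_sorted; exact: obs_le_total.
- by move=> x y; rewrite !mem_sort; exact: nt.
- by rewrite all_sort.
- by rewrite (at_tau_perm _ ps).
Qed.

Section ordinal_sample.
Context (n : nat) (u : 'I_n -> R) (delta : 'I_n -> bool) (phi : 'I_n -> R).

Definition sample : seq pt := [seq (u i, delta i, phi i) | i <- enum 'I_n].

Lemma card_count (b : pred 'I_n) (f : pred pt) :
  (forall i, f (u i, delta i, phi i) = b i) -> #|[pred i | b i]| = count f sample.
Proof.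
move=> fb; have -> : #|[pred i | b i]| = count b (enum 'I_n).
  by rewrite cardE [enum 'I_n]enumT -size_filter.
by rewrite /sample count_map; apply: eq_count => i /=; rewrite fb.
Qed.

(** For [r] close to [t] on its left, the observed times up to [r] are those
    before [t]. *)
Lemma left_lim_km (t : R) :
  left_lim (km_censoring u delta) t = km_left sample t.
Proof.
have E (r : R) : km_censoring u delta r =
    \prod_(v <- undup [seq utime y | y <- sample] | v <= r) km_factor sample v.
  rewrite /km_censoring [in RHS]/sample -map_comp; apply: eq_bigr => v _.
  rewrite (@card_count (fun i => (u i == v) && ~~ delta i)
                       (fun x => (utime x == v) && ~~ failed x))//.
  by rewrite (@card_count (fun i => v <= u i) (fun x => v <= utime x)).
rewrite /left_lim; apply: cvg_lim => //.
rewrite (_ : km_left sample t = \prod_(v <- undup [seq utime y | y <- sample] | v < t) km_factor sample v)//.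
have nr (l : seq R) :
    \forall r \near t^'-, forall v, v \in l -> (v <= r) = (v < t).
  elim: l => [|v l IH]; first by near=> r.
  have vr : \forall r \near t^'-, (v <= r) = (v < t).
    have [vt|tv] := ltP v t; near=> r.
      by apply/ltW; near: r; exact: nbhs_left_gt.
    have rt : r < t by near: r; exact: nbhs_left_lt.
    by rewrite leNgt (lt_le_trans rt tv).
  near=> r => w; rewrite inE => /predU1P[->|wl]; first by near: r.
  by move: w wl; near: r.
apply: cvg_near_cst; apply: filterS (nr (undup [seq utime y | y <- sample])) => r H.
rewrite E.
rewrite big_seq_cond [RHS]big_seq_cond; apply: eq_bigl => v.
by case: (boolP (v \in _)) => // /H ->.
Unshelve. all: by end_near. Qed.


Lemma at_tau_sample : emp_at_risk u tau = n%:R^-1 * (at_tau tau sample)%:R.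
Proof.
rewrite /emp_at_risk; congr (_ * _).
rewrite /at_tau /sample count_map -sum1_count natr_sum [in RHS]big_mkcond big_enum/=.
by apply: eq_bigr => i _; rewrite /utime /=; case: (tau <= u i).
Qed.

(** A subject at risk at [tau] is a failure, so that no mass remains after the
    last observation. *)
Lemma ipcw_sample d : (0 < n)%N ->
  (forall i j, delta i -> ~~ delta j -> u i != u j) ->
  (forall i, 0 <= phi i <= 1) -> (forall i, tau <= u i -> delta i) ->
  (0 < at_tau tau sample)%N ->
  n%:R^-1 * (\sum_(i < n) (delta i)%:R * phi i / left_lim (km_censoring u delta) (u i)) =
  km_int mu d sample.
Proof.
move=> n0 nt phi01 dtau at0; have nn : n%:R != 0 :> R by rewrite pnatr_eq0 -lt0n.
have sn : size sample = n by rewrite size_map size_enum_ord.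
apply: (mulfI nn); rewrite mulVKf//.
have := @ipcw_km_int d sample; rewrite sn => <-//.
- rewrite /sample big_map big_enum/=; apply: eq_bigr => i _.
  by rewrite left_lim_km.
- move=> x y /mapP[i _ ->] /mapP[j _ ->]; exact: nt.
- apply/allP => x /mapP[i _ ->]; rewrite /valid_obs /unit_mark /mark phi01 /=.
  by apply/implyP; exact: dtau.
Qed.

End ordinal_sample.
End kaplan_meier.

(** * The law of a censored observation *)

Section censored_law.
Context (R : realType) (dO : measure_display) (Om : measurableType dO).
Variable P : probability Om R.
Variables (T C phi psi : Om -> R) (tau : R).
Hypothesis mT : measurable_fun setT T.
Hypothesis mC : measurable_fun setT C.
Hypothesis mphi : measurable_fun setT phi.
Hypothesis mpsi : measurable_fun setT psi.
Hypothesis T0 : forall w, 0 <= T w.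
Hypothesis Ttau : forall w, T w <= tau.
Hypothesis C0 : forall w, 0 <= C w.
Hypothesis phi01 : forall w, 0 <= phi w <= 1.
Hypothesis psi01 : forall w, 0 <= psi w <= 1.
Hypothesis phi_psi : forall w, T w <= C w -> phi w = psi w.
Hypothesis indep : independent2 P (fun w => (T w, psi w)) C.

Definition surv (u : R) : R := \int[P]_w (u < T w)%R%:R.
Definition psi_after (u : R) : R := \int[P]_w ((u < T w)%R%:R * psi w).
(** The mean of [psi] given a failure after [u]; it enters multiplied by the
    probability of that event, so that the quotient by 0 is harmless. *)
Definition residual (u : R) : R := psi_after u / surv u.

Definition obs (w : Om) : R * bool * R := (obs_time T C w, obs_status T C w, phi w).

Let bpsi : bmeasurable psi.
Proof. by split=> //; exists 1 => w; have /andP[h1 h2] := psi01 w; rewrite ger0_norm. Qed.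

Let bT u : bmeasurable (fun w => (u < T w)%R%:R : R).
Proof. by apply: bmeasurable_bool; apply: measurable_fun_ltr => //; exact: measurable_cst. Qed.

Let after_le u : 0 <= psi_after u <= surv u.
Proof.
apply/andP; split.
  apply: Rintegral_ge0 => w _; have /andP[h _] := psi01 w; exact: mulr_ge0.
apply: le_Ex => // [|w]; first exact: bmeasurableM.
by have /andP[_ h] := psi01 w; rewrite ler_piMr.
Qed.

Let surv_residual u : surv u * residual u = psi_after u.
Proof.
rewrite /residual mulrC; have [s0|s0] := eqVneq (surv u) 0; last by rewrite divfK.
by rewrite s0 mulr0; have := after_le u; rewrite s0 => /le_anti.
Qed.

Lemma residual01 u : 0 <= residual u <= 1.
Proof.
have /andP[h1 h2] := after_le u; have s0 := le_trans h1 h2.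
rewrite /residual divr_ge0//=; have [->|sn] := eqVneq (surv u) 0.
  by rewrite invr0 mulr0 ler01.
by rewrite ler_pdivrMr ?mul1r// lt_neqAle eq_sym sn.
Qed.

Lemma measurable_residual : measurable_fun setT residual.
Proof.
have bt : bmeasurable (fun z : R * Om => (z.1 < T z.2)%R%:R : R).
  apply: bmeasurable_bool; apply: measurable_fun_ltr => //.
  exact: measurableT_comp.
have bp : bmeasurable (fun z : R * Om => (z.1 < T z.2)%R%:R * psi z.2).
  by apply: bmeasurableM => //; apply: (bmeasurable_comp (f := psi) (g := snd)).
have [m1 _] := bmeasurable_Ex P bt; have [m2 _] := bmeasurable_Ex P bp.
apply: measurable_funM; first exact: m2.
rewrite (_ : (fun _ => _) = (fun u => surv u `^ (- 1))).
  exact: (measurableT_comp (@measurable_powR R (- 1)) m1).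
apply/funext => u; rewrite powR_inv1//.
by have /andP[] := after_le u; exact: le_trans.
Qed.

Lemma residual_mean : residual (- 1) = \int[P]_w psi w.
Proof.
have h w : -1 < T w by apply: lt_le_trans (T0 w); rewrite ltrN10.
have s1 : surv (- 1) = 1.
  by rewrite /surv (Ex_eq P (g := fun=> 1)) ?Ex_cst// => w; rewrite h.
rewrite /residual s1 divr1 /psi_after; apply: Ex_eq => w.
by rewrite h mul1r.
Qed.

Lemma measurable_obs : measurable_fun setT obs.
Proof.
apply: measurable_fun_pair => //; apply: measurable_fun_pair.
  exact: measurable_minr.
exact: measurable_fun_ler.
Qed.

Lemma obs_valid w : valid_obs tau (obs w).
Proof.
rewrite /valid_obs /unit_mark /mark /utime /failed /= phi01 /=; apply/implyP.
by rewrite /obs_time /obs_status le_min => /andP[_]; exact: le_trans.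
Qed.

Lemma obs_after w : - 1 < utime (obs w).
Proof. by apply: (@lt_le_trans _ _ 0); rewrite ?ltrN10// le_min T0 C0. Qed.

(** Censoring is uninformative: the integral of [psi] over the failures after a
    fixed censoring time is their probability times the residual mean. *)
Lemma imputation u :
  \int[P]_w ((after obs u w)%:R *
     (if failed (obs w) then mark (obs w) else residual (utime (obs w)))) =
  prob_after P obs u * residual u.
Proof.
have bC : bmeasurable (fun w => (u < C w)%R%:R : R).
  by apply: bmeasurable_bool; apply: measurable_fun_ltr => //; exact: measurable_cst.
have mTpsi : measurable_fun setT (fun w => (T w, psi w)) by exact: measurable_fun_pair.
have E1 : prob_after P obs u = surv u * \int[P]_w (u < C w)%R%:R.
  pose F (z : R * R * R) : R := (u < z.1.1)%R%:R * (u < z.2)%R%:R.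
  have bF : bmeasurable F.
    by apply: bmeasurableM; apply: bmeasurable_bool; apply: measurable_fun_ltr => //;
      do ?[exact: measurable_cst|exact: measurable_snd|exact: measurableT_comp].
  transitivity (\int[P]_w F (T w, psi w, C w)).
    by apply: Ex_eq => w; rewrite /after /utime /= lt_min /F /= -natrM mulnb.
  rewrite (independent2_Ex mTpsi mC indep bF) /F /=.
  by rewrite -ExZr; [apply: Ex_eq => w; rewrite ExZl|exact: bT].
(* The test on [z.1.2], which always succeeds for [psi], keeps [F] bounded. *)
pose F (z : R * R * R) : R := (u < z.2)%R%:R *
  ((u < z.1.1)%R%:R * (if z.1.1 <= z.2 then (if 0 <= z.1.2 <= 1 then z.1.2 else 0) else residual z.2)).
have bF : bmeasurable F.
  have m11 : measurable_fun setT (fun z : R * R * R => z.1.1) by exact: measurableT_comp.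
  have m12 : measurable_fun setT (fun z : R * R * R => z.1.2) by exact: measurableT_comp.
  have m2 : measurable_fun setT (fun z : R * R * R => z.2) by exact: measurable_snd.
  apply: bmeasurableM.
    by apply: bmeasurable_bool; apply: measurable_fun_ltr; [exact: measurable_cst|exact: m2].
  apply: bmeasurableM.
    by apply: bmeasurable_bool; apply: measurable_fun_ltr; [exact: measurable_cst|exact: m11].
  split.
    apply: measurable_fun_ifT; [exact: measurable_fun_ler| |].
      apply: measurable_fun_ifT; [|exact: m12|exact: measurable_cst].
      apply: measurable_and; apply: measurable_fun_ler;
        by [exact: m12|exact: measurable_cst].
    exact: (measurableT_comp measurable_residual).
  exists 1 => z; case: ifP => _; last first.
    by have /andP[h1 h2] := residual01 z.2; rewrite ger0_norm.
  by case: ifP => [/andP[h1 h2]|_]; rewrite ?normr0 ?ler01 ?ger0_norm.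
transitivity (\int[P]_w F (T w, psi w, C w)).
  apply: Ex_eq => w; rewrite /F /= psi01 /after /utime /failed /mark /= lt_min /obs_time /obs_status.
  case: (leP (T w) (C w)) => tc.
    rewrite mulrA -natrM mulnb [in RHS]andbC; congr (_ * _); exact: phi_psi.
  by rewrite mulrA -natrM mulnb [in RHS]andbC.
rewrite (independent2_Ex mTpsi mC indep bF).
rewrite (Ex_fubini P P (F := fun z => F (T z.1, psi z.1, C z.2))); last first.
  apply: (bmeasurable_comp (f := F) (g := fun z : Om * Om => (T z.1, psi z.1, C z.2))) => //.
  do 2?apply: measurable_fun_pair; exact: measurableT_comp.
transitivity (\int[P]_w ((u < C w)%R%:R * psi_after u)).
  apply: Ex_eq => w'; rewrite /F /=; case: (ltP u (C w')) => uC; last first.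
    by rewrite mul0r (Ex_eq P (g := fun=> 0)) ?Ex_cst// => w; rewrite mul0r.
  rewrite mul1r.
  rewrite (Ex_eq P (g := fun w => (u < T w)%R%:R * psi w - (C w' < T w)%R%:R * psi w
       + (C w' < T w)%R%:R * residual (C w'))); last first.
    move=> w; rewrite psi01 mul1r; case: (leP (T w) (C w')) => tc.
      by rewrite !mul0r subr0 addr0.
    by rewrite (lt_trans uC tc) !mul1r subrr add0r.
  have b1 v : bmeasurable (fun w => (v < T w)%R%:R * psi w) by exact: bmeasurableM.
  rewrite ExD; [|exact: bmeasurableB|by apply: bmeasurableM => //; exact: bmeasurable_cst].
  rewrite ExB// ExZr// -/(psi_after u) -/(psi_after (C w')) -/(surv (C w')).
  by rewrite surv_residual subrK.
by rewrite ExZr// E1 mulrAC surv_residual mulrC.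
Qed.

End censored_law.

(** * Finite covers and measurability on a subset *)

Section covering.
Context (R : realType) (X : choiceType) (D : set X).

Lemma sup_norm_leP (f : X -> R) (e : R) :
  (sup_norm D f <= e%:E)%E <-> forall x, D x -> `|f x| <= e.
Proof.
split=> [h x Dx|h].
  rewrite -lee_fin; apply: le_trans h; apply: ereal_sup_ubound.
  by exists x.
by apply: ge_ereal_sup => _ [x Dx <-]; rewrite lee_fin; exact: h.
Qed.

(* Compactness in terms of open covers is formulated for pointed spaces. *)
HB.instance Definition _ := isPointed.Build {uniform` D -> R} (fun=> 0).

Lemma compact_ball_cover (F : set (X -> R)) (e : R) :
  sup_norm_compact D F -> 0 < e -> exists m, ball_cover D F e m.
Proof.
move=> cF e0; pose T : topologicalType := {uniform` D -> R}.
pose N (c : T) : set T := ([set h | forall y, D y -> `|c y - h y| < e] : set {uniform` D -> R})°.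
have Ncc c : N c c.
  apply/uniform_nbhs; exists [set xy | ball xy.1 e xy.2]; split.
    exact: (entourage_ball _ (PosNum e0)).
  by move=> h hh y Dy; exact: hh.
have := cF; rewrite /sup_norm_compact (@compact_cover {uniform` D -> R}) => /(_ T F N).
case=> [i _|f Ff|S SF FS]; first exact: open_interior.
  by exists f => //.
pose s : seq T := finmap.enum_fset S.
exists (size s), (fun j => tnth (in_tuple s) j); split.
  move=> j; have := mem_tnth j (in_tuple s) => js.
  by have := SF _ js; rewrite inE.
move=> f /FS[c /= cS /interior_subset fc].
have cs : (index c s < size s)%N by rewrite index_mem.
exists (Ordinal cs); apply/sup_norm_leP => x Dx.
rewrite (tnth_nth c) /= nth_index// distrC ltW//.
exact: fc.
Qed.

Lemma covering_numberP (F : set (X -> R)) (e : R) :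
  sup_norm_compact D F -> 0 < e -> ball_cover D F e (covering_number D F e).
Proof.
move=> cF e0; have [m mF] := compact_ball_cover cF e0.
have ex : exists m, `[< ball_cover D F e m >] by exists m; exact/asboolP.
have [k /asboolP kF kmin] := ex_minnP ex.
rewrite /covering_number.
have [] // : [set m | ball_cover D F e m /\ forall k, ball_cover D F e k -> (m <= k)%N]
   (xget 0%N [set m | ball_cover D F e m /\ forall k, ball_cover D F e k -> (m <= k)%N]).
apply: xgetPex; exists k; split => // j jF.
by apply: kmin; exact/asboolP.
Qed.

End covering.

Section trace_measurability.

Lemma measurable_on_comp (d1 d2 d3 : measure_display) (T1 : measurableType d1)
    (T2 : measurableType d2) (Th : measurableType d3) (D : set T1)
    (f : T1 -> T2) (g : Th -> T1) :
  measurable_on D f -> measurable_fun setT g -> (forall w, D (g w)) ->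
  measurable_fun setT (f \o g).
Proof.
move=> mf mg Dg _ B mB; rewrite setTI; have [C mC CD] := mf B mB.
rewrite (_ : _ @^-1` B = g @^-1` C); first by rewrite -[X in measurable X]setTI; exact: mg.
have E w : (f @^-1` B `&` D) (g w) <-> (C `&` D) (g w) by rewrite CD.
apply/seteqP; split => w /= h.
  by have [] := (E w).1 (conj h (Dg w)).
by have [] := (E w).2 (conj h (Dg w)).
Qed.

(** The preimages under [g] already form a sigma-algebra. *)
Lemma generated_preimage (Th : pointedType) (d1 d2 : measure_display)
    (W : measurableType d1) (T : measurableType d2) (g : Th -> W)
    (Thg := g_sigma_algebraType (preimage_set_system setT g (measurable : set (set W))))
    (h : Th -> T) (A : set T) :
  measurable_fun [set: Thg] (h : Thg -> T) -> measurable A ->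
  exists2 E : set W, measurable E & h @^-1` A = g @^-1` E.
Proof.
move=> mh mA; have := mh measurableT A mA; rewrite setTI => hA.
have : preimage_set_system setT g measurable (h @^-1` A).
  apply: (smallest_sub _ _ hA) => //.
  apply: sigma_algebra_preimage.
  by have := @sigma_algebra_measurable _ W.
by move=> [E mE]; rewrite setTI => <-; exists E.
Qed.

Lemma measurable_generator (Th : pointedType) (d1 : measure_display)
    (W : measurableType d1) (g : Th -> W)
    (Thg := g_sigma_algebraType (preimage_set_system setT g (measurable : set (set W)))) :
  measurable_fun [set: Thg] (g : Thg -> W).
Proof.
by move=> _ B mB; rewrite setTI; apply: sub_sigma_algebra; exists B => //; rewrite setTI.
Qed.

End trace_measurability.

(** * The deviation of the empirical risk of one function *)

Lemma measurable_loss (R : realType) (d : nat) (tau : R) (ZZ : set (d.-tuple R))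
    (L : R -> R -> R) (f : R * d.-tuple R -> R) (d' : measure_display)
    (Th : measurableType d') (t : Th -> R) (z : Th -> d.-tuple R) (y : Th -> R) :
  measurable_fun setT (fun p : R * R => L p.1 p.2) ->
  measurable_on (`[0, tau]%classic `*` ZZ) f ->
  measurable_fun setT t -> measurable_fun setT z -> measurable_fun setT y ->
  (forall w, 0 <= t w <= tau) -> (forall w, ZZ (z w)) ->
  measurable_fun setT (fun w => L (y w) (f (t w, z w))).
Proof.
move=> mL mf mt mz my ht hz.
have m1 : measurable_fun setT (fun w => f (t w, z w)).
  apply: (measurable_on_comp mf (measurable_fun_pair mt mz)) => w.
  by split=> //=; rewrite in_itv /=.
exact: (measurableT_comp mL (measurable_fun_pair my m1)).
Qed.

Section one_function.
Context (R : realType) (dO : measure_display) (Om : measurableType dO).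
Variables (P : probability Om R) (tau : R) (d : nat) (ZZ : set (d.-tuple R)).
Variables (T C Y : {RV P >-> R}) (Z : {RV P >-> d.-tuple R}) (n : nat).
Variables (Ti Ci Yi : 'I_n -> {RV P >-> R}) (Zi : 'I_n -> {RV P >-> d.-tuple R}).
Hypothesis n0 : (0 < n)%N.
Hypothesis C0 : forall w, 0 <= C w.
Hypothesis ZZZ : forall w, ZZ (Z w).
Hypothesis indep : independent2 P (fun w => (T w, Z w, Y w)) C.
Hypothesis T0tau : forall w, 0 <= T w <= tau.
Hypothesis TC0 : P [set w | T w = C w] = 0%E.
Hypothesis sampleD : forall i w, [/\ 0 <= Ci i w, 0 <= Ti i w <= tau & ZZ (Zi i w)].
Hypothesis ind_sample :
  mutually_independent P (fun i => observation (Ti i) (Ci i) (Zi i) (Yi i)).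
Hypothesis same_law : forall i, same_distribution P
  (observation (Ti i) (Ci i) (Zi i) (Yi i)) (observation T C Z Y).

Let D : set (R * d.-tuple R) := `[0, tau]%classic `*` ZZ.

Variables (L : R -> R -> R) (B : R) (f : R * d.-tuple R -> R).
Hypothesis B0 : 0 < B.
Hypothesis mL : measurable_fun setT (fun p : R * R => L p.1 p.2).
Hypothesis mf : measurable_on D f.
Hypothesis LB : forall y t z, 0 <= t <= tau -> ZZ z -> 0 <= L y (f (t, z)) <= B.

Definition scaled_loss (t : R) (z : d.-tuple R) (y : R) : R := L y (f (t, z)) / B.

Lemma scaled_loss01 t z y : 0 <= t <= tau -> ZZ z ->
  0 <= scaled_loss t z y <= 1.
Proof.
move=> ht hz; have /andP[h1 h2] := LB y ht hz.
by rewrite /scaled_loss divr_ge0 ?(ltW B0)//= ler_pdivrMr// mul1r.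
Qed.

Lemma measurable_scaled_loss (d' : measure_display) (Th : measurableType d')
    (t : Th -> R) (z : Th -> d.-tuple R) (y : Th -> R) :
  measurable_fun setT t -> measurable_fun setT z -> measurable_fun setT y ->
  (forall w, 0 <= t w <= tau) -> (forall w, ZZ (z w)) ->
  measurable_fun setT (fun w => scaled_loss (t w) (z w) (y w)).
Proof.
move=> mt mz my ht hz; apply: measurable_funM; last exact: measurable_cst.
exact: (measurable_loss mL mf).
Qed.

Let phi w := scaled_loss (obs_time T C w) (Z w) (Y w).
Let psi w := scaled_loss (T w) (Z w) (Y w).
Let phis i w := scaled_loss (obs_time (Ti i) (Ci i) w) (Zi i w) (Yi i w).
Let X := obs T C phi.
Let Xs i := obs (Ti i) (Ci i) (phis i).

Let U0tau w : 0 <= obs_time T C w <= tau.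
Proof.
have /andP[h1 h2] := T0tau w.
by rewrite /obs_time le_min h1 C0/= ge_min h2.
Qed.

Let Ui0tau i w : 0 <= obs_time (Ti i) (Ci i) w <= tau.
Proof.
have [c0 /andP[h1 h2] _] := sampleD i w.
by rewrite /obs_time le_min h1 c0/= ge_min h2.
Qed.

Let mU : measurable_fun setT (obs_time T C).
Proof. exact: measurable_minr. Qed.

Let mUi i : measurable_fun setT (obs_time (Ti i) (Ci i)).
Proof. exact: measurable_minr. Qed.

Let mphi : measurable_fun setT phi.
Proof. exact: measurable_scaled_loss. Qed.

Let mphis i : measurable_fun setT (phis i).
Proof. by apply: measurable_scaled_loss => // w; have [] := sampleD i w. Qed.

Let mpsi : measurable_fun setT psi.
Proof. exact: measurable_scaled_loss. Qed.

Let mX : measurable_fun setT X.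
Proof. exact: measurable_obs. Qed.

Let mXs i : measurable_fun setT (Xs i).
Proof. exact: measurable_obs. Qed.

Let indep_psi : independent2 P (fun w => (T w, psi w)) C.
Proof.
pose g w := (T w, Z w, Y w).
pose Og := g_sigma_algebraType (preimage_set_system setT g measurable).
have mg : measurable_fun [set: Og] (g : Og -> _) by exact: measurable_generator.
have mg1 : measurable_fun [set: Og] (fun w : Og => (g w).1) by exact: measurableT_comp.
have m1 : measurable_fun [set: Og] (fun w : Og => (T w, psi w)).
  apply: measurable_fun_pair.
    by apply: (measurableT_comp measurable_fst mg1).
  apply: measurable_scaled_loss => //.
  - exact: (measurableT_comp measurable_fst mg1).
  - exact: (measurableT_comp measurable_snd mg1).
  - exact: (measurableT_comp measurable_snd mg).
move=> A1 A2 mA1 mA2.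
have [E mE EE] := generated_preimage m1 mA1.
by rewrite EE; exact: indep.
Qed.

Let indep_TC : independent2 P T C.
Proof.
move=> A1 A2 mA1 mA2.
have -> : T @^-1` A1 = (fun w => (T w, psi w)) @^-1` (A1 `*` setT).
  by apply/seteqP; split => w //= [].
by apply: indep_psi => //; exact: measurableX.
Qed.

(** One event [E] serves the population and all members of the sample, because
    they are put on one space, a copy of [Om] for each of them, before the
    factorization through the observation is applied. *)
Let same_event (A : set (R * bool * R)) : measurable A ->
  exists2 E, measurable E & X @^-1` A = observation T C Z Y @^-1` E /\
    forall i, Xs i @^-1` A = observation (Ti i) (Ci i) (Zi i) (Yi i) @^-1` E.
Proof.
move=> mA; pose Th : pointedType := (nat * Om)%type.
pose W := (R * bool * d.-tuple R * R)%type.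
pose g (th : Th) : W := if insub th.1 is Some i
  then observation (Ti i) (Ci i) (Zi i) (Yi i) th.2 else observation T C Z Y th.2.
pose Thg := g_sigma_algebraType (preimage_set_system setT g measurable).
have mg : measurable_fun [set: Thg] (g : Thg -> W) by exact: measurable_generator.
have mg1 : measurable_fun [set: Thg] (fun w : Thg => (g w).1) by exact: measurableT_comp.
have mg11 : measurable_fun [set: Thg] (fun w : Thg => (g w).1.1).
  exact: (measurableT_comp measurable_fst mg1).
pose h (th : Th) : R * bool * R :=
  ((g th).1.1.1, (g th).1.1.2, scaled_loss (g th).1.1.1 (g th).1.2 (g th).2).
have mh : measurable_fun [set: Thg] (h : Thg -> _).
  apply: measurable_fun_pair.
    apply: measurable_fun_pair.
      exact: (measurableT_comp measurable_fst mg11).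
    exact: (measurableT_comp measurable_snd mg11).
  apply: measurable_scaled_loss.
  - exact: (measurableT_comp measurable_fst mg11).
  - exact: (measurableT_comp measurable_snd mg1).
  - exact: (measurableT_comp measurable_snd mg).
  - by move=> th; rewrite /g; case: insub => [i|]; [exact: Ui0tau|exact: U0tau].
  - by move=> th; rewrite /g; case: insub => [i|] //=; have [] := sampleD i th.2.
have [E mE EE] := generated_preimage mh mA.
exists E => //; split=> [|i].
  have EEn (w : Om) : (h @^-1` A) (n, w) = (g @^-1` E) (n, w) by rewrite EE.
  apply/funext => w; move: (EEn w).
  by rewrite /preimage /= /h /g /= insubF ?ltnn.
have EEi (w : Om) : (h @^-1` A) (nat_of_ord i, w) = (g @^-1` E) (nat_of_ord i, w) by rewrite EE.
apply/funext => w; move: (EEi w).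
by rewrite /preimage /= /h /g /= valK.
Qed.

Let iidX (J : {set 'I_n}) (A : 'I_n -> set (R * bool * R)) :
  (forall i, i \in J -> measurable (A i)) ->
  P (\bigcap_(i in [set` J]) (Xs i @^-1` A i)) = (\prod_(i in J) P (X @^-1` A i))%E.
Proof.
move=> mA; have : forall i, exists E : set (R * bool * d.-tuple R * R), i \in J ->
  [/\ measurable E, X @^-1` A i = observation T C Z Y @^-1` E &
     Xs i @^-1` A i = observation (Ti i) (Ci i) (Zi i) (Yi i) @^-1` E].
  move=> i; have [iJ|] := boolP (i \in J); last by exists set0.
  by have [E mE [h1 h2]] := same_event (mA i iJ); exists E.
move=> /choice[E HE].
transitivity (P (\bigcap_(i in [set` J])
   (observation (Ti i) (Ci i) (Zi i) (Yi i) @^-1` E i))).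
  by congr (P _); apply: eq_bigcapr => i /HE[].
rewrite ind_sample; last by move=> i /HE[].
apply: eq_bigr => i iJ; have [mE -> _] := HE i iJ.
exact: same_law.
Qed.

Let sampleX w := [seq Xs i w | i <- enum 'I_n].

Let sampleE w : sampleX w = sample (fun i => obs_time (Ti i) (Ci i) w)
   (fun i => obs_status (Ti i) (Ci i) w) (phis^~ w).
Proof. by []. Qed.

Let tie x y : bool := [&& @failed R x, ~~ failed y & utime x == utime y].

Let measurable_tie (d' : measure_display) (Th : measurableType d')
    (x y : Th -> R * bool * R) :
  measurable_fun setT x -> measurable_fun setT y ->
  measurable_fun setT (fun th => tie (x th) (y th)).
Proof.
move=> mx my; apply: measurable_and.
  exact: (measurableT_comp (@measurable_failed R) mx).
apply: measurable_and.
  apply: measurable_neg.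
  exact: (measurableT_comp (@measurable_failed R) my).
by apply: measurable_fun_eqr; [exact: (measurableT_comp (@measurable_utime R) mx)
  |exact: (measurableT_comp (@measurable_utime R) my)].
Qed.

(** In terms of two independent copies, a tie of a failure with a censoring says
    that independent versions of [T] and [C] coincide, which is as improbable as
    [T = C] since [T] and [C] are independent. *)
Let tie_null i j : \int[P]_w (tie (Xs i w) (Xs j w))%:R = 0 :> R.
Proof.
have [->|ij] := eqVneq i j.
  by rewrite (Ex_eq P (g := fun=> 0)) ?Ex_cst// => w; rewrite /tie; case: (failed _).
pose pt0 : R * bool * R := (0, false, 0).
pose F (s : seq (R * bool * R)) : R := (tie (nth pt0 s 0) (nth pt0 s 1))%:R.
have bF : seq_bmeasurable F.
  apply: seq_bmeasurable_bool => d' Th xs mxs.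
  under eq_fun => th do rewrite !eval_seq_nth.
  by apply: measurable_tie; apply: all_measurable_nth => //; exact: measurable_cst.
have uij : uniq [:: i; j] by rewrite /= inE ij.
have := iid_sample_mean mXs mX iidX bF uij; rewrite /F /= => ->.
apply/le_anti/andP; split; last first.
  by apply: Rintegral_ge0 => w _; exact: Rintegral_ge0.
have mTC : measurable_fun setT (fun z : R * R => z.1 == z.2).
  exact: measurable_fun_eqr.
have bTC : bmeasurable (fun z : R * R => (z.1 == z.2)%:R : R) by exact: bmeasurable_bool.
apply: (@le_trans _ _ (\int[P]_w \int[P]_w' (T w == C w')%:R)).
  have b1 : bmeasurable (fun z : Om * Om => (tie (X z.1) (X z.2))%:R : R).
    by apply: bmeasurable_bool; apply: measurable_tie; exact: measurableT_comp.
  have b2 : bmeasurable (fun z : Om * Om => (T z.1 == C z.2)%:R : R).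
    by apply: bmeasurable_bool; apply: measurable_fun_eqr; exact: measurableT_comp.
  apply: le_Ex => [||w]; [exact: (bmeasurable_Ex P b1)|exact: (bmeasurable_Ex P b2)|].
  apply: le_Ex => [||w']; [exact: (bmeasurable_pair1 w b1)|exact: (bmeasurable_pair1 w b2)|].
  rewrite ler_nat /tie /failed /utime /= /obs_status /obs_time.
  case: leP => //= TC; case: leP => //= CT.
rewrite -(independent2_Ex (F := fun z => (z.1 == z.2)%:R) _ _ indep_TC)//.
rewrite -lee_fin Ex_indic.
  rewrite (_ : [set x | T x == C x] = [set w | T w = C w]) ?TC0//.
  by apply/seteqP; split => w /= /eqP.
by apply: measurable_fun_eqr.
Qed.

(** With [s = sqrt (2 n x)], [t = 4 s] and [l = s / (2 n)], the exponent in the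
    tail bound is [- 2 x]. For [n < 18 x] this [l] is too large for that bound,
    but then [t] exceeds [n], which the deviation cannot. *)
Lemma one_function_deviation (x : R) : 0 < x ->
  exists A : set Om, [/\ measurable A, (P (~` A) <= (2 * expR (- (2 * x)))%:E)%E &
    forall w, A w ->
     (forall i j, obs_status (Ti i) (Ci i) w -> ~~ obs_status (Ti j) (Ci j) w ->
        obs_time (Ti i) (Ci i) w != obs_time (Ti j) (Ci j) w) /\
     Hhat Ti Ci tau w * `|emp_risk Ti Ci Zi Yi L f w - risk P T Z Y L f| <=
       B * ((1 + 4 * Num.sqrt (2 * n%:R * x)) / n%:R)].
Proof.
move=> x0; set t := 4 * Num.sqrt _.
pose mu := residual P T psi; pose c := mu (- 1).
have T0 w : 0 <= T w by have /andP[] := T0tau w.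
have Ttau w : T w <= tau by have /andP[] := T0tau w.
have phi01 w : 0 <= phi w <= 1 by exact: scaled_loss01.
have psi01 w : 0 <= psi w <= 1 by exact: scaled_loss01.
have phi_psi w : T w <= C w -> phi w = psi w.
  by move=> tc; rewrite /phi /obs_time (min_idPl tc).
have mu01 u : 0 <= mu u <= 1 by exact: residual01.
have mmu : measurable_fun setT mu by exact: measurable_residual.
have validX w : valid_obs tau (X w) by exact: obs_valid.
have afterX w : - 1 < utime (X w) by exact: obs_after.
have bpsi : bmeasurable psi.
  by split=> //; exists 1 => w; have /andP[h1 h2] := psi01 w; rewrite ger0_norm.
have riskE : risk P T Z Y L f = B * c.
  rewrite /c /mu residual_mean// -ExZl// /risk unlock.
  congr fine; apply: eq_integral => w _.
  by rewrite /psi /scaled_loss mulrC divfK ?gt_eqF.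
have mT : measurable_fun setT T by [].
have mC : measurable_fun setT C by [].
have imp := imputation mT mC mpsi psi01 phi_psi indep_psi.
pose bad s : bool := 1 + t <= `|km_dev tau mu c c s|.
have n1 : 0 < n%:R :> R by rewrite ltr0n.
have s2 : Num.sqrt (2 * n%:R * x) ^+ 2 = 2 * n%:R * x.
  by rewrite sqr_sqrtr// !mulr_ge0// ltW.
have s0 : 0 <= Num.sqrt (2 * n%:R * x) by exact: sqrtr_ge0.
have sbad : seq_bmeasurable (fun s => (bad s)%:R : R).
  apply: seq_bmeasurable_bool => d' Th xs mxs; apply: measurable_fun_ler; first exact: measurable_cst.
  apply: measurableT_comp => //; exact: (seq_measurable_km_dev tau c c mmu mxs).
have tail : \int[P]_w (bad (sampleX w))%:R <= 2 * expR (- (2 * x)).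
  rewrite (iid_sample_mean mXs mX iidX sbad (enum_uniq _)) size_enum_ord.
  have [xn|nx] := leP (18 * x) n%:R.
    pose l := Num.sqrt (2 * n%:R * x) / (2 * n%:R).
    have l0 : 0 <= l by rewrite divr_ge0// mulr_ge0// ltW.
    have l2 : l * 2 <= 1 / 3.
      rewrite (_ : l * 2 = Num.sqrt (2 * n%:R * x) / n%:R); last first.
        by rewrite /l; field; rewrite gt_eqF.
      rewrite ler_pdivrMr// -(@ler_pXn2r _ 2)// ?nnegrE ?mulr_ge0 ?(ltW n1)// s2.
      by rewrite -subr_ge0 (_ : _ - _ = n%:R * (n%:R - 18 * x) / 9);
        [rewrite divr_ge0// mulr_ge0 ?(ltW n1)// subr_ge0|field].
    have unitX w : unit_mark (X w) by case/andP: (validX w).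
    have := km_dev_tail mX mmu mu01 unitX imp validX afterX n t l0 l2.
    congr (_ <= _ * expR _).
    have -> : l * t = 4 * (Num.sqrt (2 * n%:R * x) ^+ 2) / (2 * n%:R).
      by rewrite /l /t; field; rewrite gt_eqF.
    have -> : (l * 2) ^+ 2 = Num.sqrt (2 * n%:R * x) ^+ 2 / n%:R ^+ 2.
      by rewrite /l; field; rewrite gt_eqF.
    by rewrite s2; field; rewrite gt_eqF.
  rewrite (iid_mean_eq P (g := fun=> 0)).
    by rewrite iid_mean_cst mulr_ge0// expR_ge0.
  move=> s sn; rewrite /bad (_ : _ <= _ = false)//; apply/negbTE; rewrite -ltNge.
  have vs : all (@unit_mark R) [seq X w | w <- s].
    by rewrite all_map; apply/allP => w _ /=; case/andP: (validX w).
  have /andP[k0 k1] := km_int01 mu01 (mu01 (- 1)) vs.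
  have /andP[c0 c1] := mu01 (- 1).
  have : `|km_dev tau mu c c [seq X w | w <- s]| <= n%:R.
    rewrite normrM -[leRHS]mulr1; apply: ler_pM => //.
      by rewrite ger0_norm// ler_nat -sn -(size_map X) count_size.
    by rewrite ler_norml; apply/andP; split; rewrite -/c in k0 k1 c0 c1 *; lra.
  move/le_lt_trans; apply.
  have : n%:R / 3 < Num.sqrt (2 * n%:R * x).
    rewrite -(@ltr_pXn2r _ 2)// ?nnegrE ?divr_ge0 ?(ltW n1)// s2.
    rewrite -subr_gt0 (_ : _ - _ = n%:R * (18 * x - n%:R) / 9);
      [by rewrite divr_gt0// mulr_gt0// subr_gt0|by field].
  by rewrite /t; lra.
pose N w : R := \sum_(i < n) \sum_(j < n) (tie (Xs i w) (Xs j w))%:R.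
have btie i j : bmeasurable (fun w => (tie (Xs i w) (Xs j w))%:R : R).
  by apply: bmeasurable_bool; exact: measurable_tie.
have bsum (I : Type) (r : seq I) (G : I -> Om -> R) : (forall i, bmeasurable (G i)) ->
    bmeasurable (fun w => \sum_(i <- r) G i w) /\
    \int[P]_w (\sum_(i <- r) G i w) = \sum_(i <- r) \int[P]_w G i w.
  move=> bG; elim: r => [|i r [IH1 IH2]].
    rewrite (_ : (fun w => _) = (fun=> 0)); last by apply/funext => w; rewrite big_nil.
    by rewrite big_nil Ex_cst; split=> //; exact: bmeasurable_cst.
  rewrite (_ : (fun w => _) = (fun w => G i w + \sum_(i <- r) G i w)); last first.
    by apply/funext => w; rewrite big_cons.
  by rewrite big_cons -IH2 ExD//; split => //; exact: bmeasurableD.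
have bN1 i := (bsum _ (index_enum 'I_n) (fun j w => (tie (Xs i w) (Xs j w))%:R) (btie i)).1.
have [bN N0] := bsum _ (index_enum 'I_n) _ bN1.
have {}N0 : \int[P]_w N w = 0.
  rewrite N0 big1// => i _.
  by rewrite (bsum _ _ _ (btie i)).2 big1// => j _; exact: tie_null.
have Nge0 w : 0 <= N w by apply: sumr_ge0 => i _; apply: sumr_ge0.
have mbad : measurable_fun setT (fun w => bad (sampleX w)).
  apply: measurable_fun_ler; first exact: measurable_cst.
  apply: measurableT_comp => //.
  pose xs := [seq Xs i | i <- enum 'I_n].
  have mxs : all_measurable xs by rewrite /xs; elim: (enum _) => //= i r IH; split.
  have := seq_measurable_km_dev tau c c mmu mxs.
  by congr measurable_fun; apply/funext => w; rewrite /eval_seq /xs -map_comp.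
pose out w : bool := (1 <= N w) || bad (sampleX w).
have mout : measurable_fun setT out.
  apply: measurable_or => //; apply: measurable_fun_ler; first exact: measurable_cst.
  by have [] := bN.
exists [set w | ~~ out w]; split.
- have := measurable_neg mout => /(_ measurableT [set true] I).
  by rewrite setTI; congr measurable.
- rewrite (_ : ~` _ = [set w | out w]); last first.
    by apply/seteqP; split => w /=; [move/negP; rewrite negbK|move=> ->].
  rewrite -Ex_indic// lee_fin; apply: le_trans tail.
  rewrite -[leRHS]add0r -N0 -ExD; [|exact: bN|exact: bmeasurable_bool].
  apply: le_Ex => [||w]; first exact: bmeasurable_bool.
    by apply: bmeasurableD; [exact: bN|exact: bmeasurable_bool].
  rewrite /out; case: (lerP 1 (N w)) => h /=.
    by rewrite (le_trans h)// lerDl.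
  by rewrite lerDr.
move=> w /=; rewrite negb_or -!ltNge => /andP[Nw badw].
have nt i j : obs_status (Ti i) (Ci i) w -> ~~ obs_status (Ti j) (Ci j) w ->
    obs_time (Ti i) (Ci i) w != obs_time (Ti j) (Ci j) w.
  move=> di dj; apply/negP => uij; move: Nw; apply/negP; rewrite -leNgt.
  rewrite /N (bigD1 i)//= (bigD1 j)//= (_ : tie _ _); last by rewrite /tie; apply/and3P; split.
  by rewrite -addrA lerDl addr_ge0// ?sumr_ge0// => k _; rewrite sumr_ge0.
split => //.
have HE : Hhat Ti Ci tau w = n%:R^-1 * (at_tau tau (sampleX w))%:R.
  by rewrite /Hhat (at_tau_sample _ _ (fun i => obs_status (Ti i) (Ci i) w) (phis^~ w)).
have t0 : 0 <= t by rewrite mulr_ge0.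
have [a0|a0] := posnP (at_tau tau (sampleX w)).
  rewrite HE a0 mulr0 mul0r mulr_ge0 ?(ltW B0)//.
  by rewrite divr_ge0 ?(ltW n1)// addr_ge0.
have eE : emp_risk Ti Ci Zi Yi L f w = B * km_int mu c (sampleX w).
  have phis01 i : 0 <= phis i w <= 1.
    by apply: scaled_loss01; [exact: Ui0tau|have [] := sampleD i w].
  have dtau i : tau <= obs_time (Ti i) (Ci i) w -> obs_status (Ti i) (Ci i) w.
    rewrite /obs_time /obs_status le_min => /andP[_]; apply: le_trans.
    by have [_ /andP[]] := sampleD i w.
  rewrite sampleE -(ipcw_sample mu c n0 nt phis01 dtau)//.
  rewrite /emp_risk [RHS]mulrCA; congr (_ * _).
  rewrite mulr_sumr; apply: eq_bigr => i _.
  have [tc|tc] := boolP (obs_status _ _ w); last by rewrite !mul0r mulr0.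
  rewrite !mul1r /phis /obs_time (min_idPl tc) /scaled_loss mulrA mulrCA.
  by rewrite divff ?mulr1// gt_eqF.
rewrite HE eE riskE -mulrBr normrM (gtr0_norm B0) mulrCA ler_wpM2l ?(ltW B0)//.
rewrite -mulrA mulrC ler_wpM2r ?invr_ge0 ?(ltW n1)// ltW//.
move: badw; rewrite /km_dev normrM ger0_norm//.
Qed.

End one_function.

(** * Empirical risk minimization *)

(** The minimizer is empirically at least as good as any [f], and the passage
    between empirical and true risk costs [b / h] for each of the two. *)
Lemma erm_gap (R : realType) (E : Type) (F : set E) (r e : E -> R) (g : E)
  (h b : R) :
  0 < h -> F g -> (forall f, F f -> 0 <= r f) ->
  (forall f, F f -> e g <= e f) ->
  (forall f, F f -> h * `|e f - r f| <= b) ->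
  h * `|r g - inf [set r f | f in F]| <= 2 * b.
Proof.
move=> h0 Fg r0 eg hb.
have ne : [set r f | f in F] !=set0 by exists (r g), g.
have lb0 : has_lbound [set r f | f in F] by exists 0 => _ [f Ff <-]; exact: r0.
have i1 : inf [set r f | f in F] <= r g by apply: ge_inf => //; exists g.
have i2 : r g - 2 * b / h <= inf [set r f | f in F].
  apply: lb_le_inf => // _ [f Ff <-].
  have := hb _ Fg; have := hb _ Ff; have := eg _ Ff.
  rewrite -!ler_pdivlMl// !ler_norml => h1 /andP[h2 h3] /andP[h4 h5].
  have -> : 2 * b / h = h^-1 * b + h^-1 * b by field; rewrite gt_eqF.
  lra.
rewrite ger0_norm ?subr_ge0// -ler_pdivlMl//.
have -> : h^-1 * (2 * b) = 2 * b / h by rewrite mulrC.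
by rewrite lerBlDr addrC -lerBlDr.
Qed.

Section approximation.
Context (R : realType) (Om V : Type) (n : nat) (T C Y : 'I_n -> Om -> R).
Context (Z : 'I_n -> Om -> V) (w : Om) (tau : R).
Hypothesis n0 : (0 < n)%N.
Hypothesis Ttau : forall i, T i w <= tau.
Hypothesis nt : forall i j, obs_status (T i) (C i) w -> ~~ obs_status (T j) (C j) w ->
  obs_time (T i) (C i) w != obs_time (T j) (C j) w.
Hypothesis at_risk : 0 < Hhat T C tau w.

Lemma Ghat_left01 t : 0 <= left_lim (Ghat T C w) t <= 1.
Proof. by rewrite /Ghat (left_lim_km _ _ (fun=> 0)) km_left01. Qed.

(** The weights of the failures add up to at most 1, as the case of all marks
    equal to 1 of the Kaplan--Meier integral shows. *)
Lemma emp_risk_lipschitz (L : R -> R -> R) (f g : R * V -> R) (k : R)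
  : 0 <= k ->
  (forall i, `|L (Y i w) (f (T i w, Z i w)) - L (Y i w) (g (T i w, Z i w))| <= k) ->
  `|emp_risk T C Z Y L f w - emp_risk T C Z Y L g w| <= k.
Proof.
move=> k0 hk; set u := fun i => obs_time (T i) (C i) w.
set dl := fun i => obs_status (T i) (C i) w.
have m0 : (0 < at_tau tau (sample u dl (fun=> 1%R)))%N.
  have := at_risk; rewrite /Hhat (at_tau_sample _ _ dl (fun=> 1)).
  by case: at_tau => //; rewrite mulr0 ltxx.
have dtau i : tau <= u i -> dl i.
  by rewrite /u /dl /obs_time /obs_status le_min => /andP[_]; exact: le_trans.
have one01 (i : 'I_n) : 0 <= (1 : R) <= 1 by rewrite ler01 lexx.
have z01 (t : R) : 0 <= (fun=> 0 : R) t <= 1 by rewrite lexx ler01.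
have /andP[_ mass] : 0 <= km_int (fun=> 0) 0 (sample u dl (fun=> 1)) <= 1.
  apply: km_int01; [exact: z01|by rewrite lexx ler01|].
  by apply/allP => x /mapP[i _ ->]; exact: one01.
rewrite -(ipcw_sample _ _ n0 nt one01 dtau m0) in mass.
rewrite /emp_risk -mulrBr -sumrB.
apply: (@le_trans _ _ (n%:R^-1 * \sum_(i < n) k * ((dl i)%:R * 1 / left_lim (Ghat T C w) (u i)))); last first.
  by rewrite -mulr_sumr mulrCA -[leRHS]mulr1 ler_wpM2l.
rewrite normrM ger0_norm ?invr_ge0// ler_wpM2l ?invr_ge0//.
apply: le_trans (ler_norm_sum _ _ _) _; apply: ler_sum => i _.
rewrite -/(dl i); have [tc|tc] := boolP (dl i); last by rewrite !mul0r subrr normr0 mulr0.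
rewrite !mul1r -mulrBl normrM /u /obs_time (min_idPl tc).
have /andP[g0 _] := Ghat_left01 (T i w).
by rewrite [`|_^-1|]ger0_norm ?invr_ge0// ler_wpM2r ?invr_ge0.
Qed.

End approximation.

Theorem lemma9 (R : realType) :
  exists Do : R,
  forall (dO : measure_display) (Omega : measurableType dO)
    (P : probability Omega R) (tau : R) (d : nat) (ZZ : set (d.-tuple R))
    (T C Y : {RV P >-> R}) (Z : {RV P >-> d.-tuple R})
    (n : nat) (Ti Ci Yi : 'I_n -> {RV P >-> R})
    (Zi : 'I_n -> {RV P >-> d.-tuple R}),
  0 < tau ->
  (0 < n)%N ->
  (forall w, 0 <= C w) ->
  (forall w, ZZ (Z w)) ->
  (* (A1) *)
  independent2 P (fun w => (T w, Z w, Y w)) C ->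
  (* (A2) *)
  (forall w, 0 <= T w <= tau) ->
  (0 < P [set w | (tau <= obs_time T C w)%R])%E ->
  (* (A3) *)
  P [set w | T w = C w] = 0%E ->
  (* the sample: observed quantities are i.i.d. copies of (U, delta, Z, Y) *)
  (forall i w, [/\ 0 <= Ci i w, 0 <= Ti i w <= tau & ZZ (Zi i w)]) ->
  mutually_independent P
    (fun i => observation (Ti i) (Ci i) (Zi i) (Yi i)) ->
  (forall i, same_distribution P
     (observation (Ti i) (Ci i) (Zi i) (Yi i)) (observation T C Z Y)) ->
  forall (F : set (R * d.-tuple R -> R)) (M : R),
  let D : set (R * d.-tuple R) := `[0, tau]%classic `*` ZZ in
  0 < M ->
  sup_norm_compact D F ->
  (forall f, F f -> measurable_on D f) ->
  (forall f, F f -> P.-integrable setT (fun w => (f (T w, Z w))%:E)) ->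
  (forall f, F f -> (sup_norm D f <= M%:E)%E) ->
  forall (L : R -> R -> R) (B LM : R),
  loc_lipschitz_loss L ->
  (forall f, F f -> forall y t z, 0 <= t <= tau -> ZZ z -> L y (f (t, z)) <= B) ->
  (forall s s', - M <= s <= M -> - M <= s' <= M ->
     forall y, `|L y s - L y s'| <= LM * `|s - s'|) ->
  forall fn : Omega -> R * d.-tuple R -> R,
  is_erm Ti Ci Zi Yi L F fn ->
  forall eta eps : R, 0 < eta -> 0 < eps ->
  (* the set of w where the bound holds need not be measurable: it contains an
     event of the required probability *)
  exists A : set Omega,
    [/\ measurable A,
        ((1 - 11 / 2 * expR (- eta))%:E <= P A)%E &
        forall w, A w ->
          Hhat Ti Ci tau w * (left_lim (Ghat Ti Ci w) tau) ^+ 2 / B *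
            `|risk P T Z Y L (fn w) - inf [set risk P T Z Y L f | f in F]|
          <= (8 * Num.sqrt (2 * eta + 2 * ln (covering_number D F eps)%:R)
                + 6 * Do) / Num.sqrt n%:R
             + 4 * eps * LM / B].
Proof.
(* [6 / sqrt n] dominates the [2 / n] left by the centering. *)
exists 1 => dO Om P tau d ZZ T C Y Z n Ti Ci Yi Zi tau0 n0 C0 ZZZ indep T0tau _ TC0.
move=> sampleD ind_sample same_law F M D M0 cF mF _ FM L B LM [L0 mL _] LB Llip.
move=> fn ermfn eta eps eta0 eps0.
have Ffn : F (fn point) by have [] := ermfn point.
have D1 (t : R) z : 0 <= t <= tau -> ZZ z -> D (t, z).
  by move=> ht hz; split=> //=; rewrite in_itv.
have LB1 f : F f -> forall y t z, 0 <= t <= tau -> ZZ z -> 0 <= L y (f (t, z)) <= B.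
  by move=> Ff y t z ht hz; rewrite L0 LB.
have B0 : 0 <= B.
  by have /andP[h1 h2] := LB1 _ Ffn 0 _ _ (T0tau point) (ZZZ point); exact: le_trans h2.
have LM0 : 0 <= LM.
  have hM : - M <= M <= M by rewrite lexx andbT; lra.
  have hM' : - M <= - M <= M by rewrite lexx /=; lra.
  have := le_trans (normr_ge0 _) (Llip _ _ hM hM' 0).
  by rewrite pmulr_lge0// normr_gt0 opprK; lra.
have FMD f : F f -> forall t z, 0 <= t <= tau -> ZZ z -> - M <= f (t, z) <= M.
  move=> Ff t z ht hz; have /sup_norm_leP := FM _ Ff => /(_ (t, z) (D1 _ _ ht hz)).
  by rewrite ler_norml.
have sn0 : 0 < Num.sqrt n%:R :> R by rewrite sqrtr_gt0 ltr0n.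
have rhs0 (N : R) : 0 <= (8 * Num.sqrt N + 6 * 1) / Num.sqrt n%:R + 4 * eps * LM / B.
  by rewrite addr_ge0 ?divr_ge0 ?addr_ge0 ?mulr_ge0 ?sqrtr_ge0 ?(ltW sn0) ?(ltW eps0).
(* For [B = 0] the left-hand side is 0, as division by 0 gives 0. *)
have [Bz|Bp] := eqVneq B 0.
  exists setT; split=> // [|w _]; last first.
    by apply: le_trans (rhs0 _); rewrite Bz invr0 mulr0 mul0r.
  by rewrite probability_setT lee_fin gerBl mulr_ge0 ?expR_ge0.
have {Bp}B0 : 0 < B by rewrite lt_neqAle eq_sym Bp.
have := covering_numberP cF eps0; set N := covering_number _ _ _ => -[c [Fc cov]].
have N0 : (0 < N)%N by have [j _] := cov _ Ffn; exact: leq_ltn_trans (ltn_ord j).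
pose x : R := eta + ln N%:R.
have lnN0 : 0 <= ln N%:R :> R by rewrite ln_ge0// ler1n.
have x0 : 0 < x by rewrite /x ltr_wpDr.
have eN : expR (- x) = expR (- eta) / N%:R.
  by rewrite /x opprD expRD [expR (- ln _)]expRN lnK// posrE ltr0n.
have km_dev j := one_function_deviation n0 C0 ZZZ indep T0tau TC0 sampleD ind_sample
  same_law B0 mL (mF _ (Fc j)) (LB1 _ (Fc j)) x0.
have {km_dev}/choice[A HA] := km_dev.
pose bad k : set Om := if insub k is Some j then ~` A j else set0.
have mbad k : measurable (bad k).
  by rewrite /bad; case: insub => // j; apply: measurableC; have [] := HA j.
(* The union bound yields [N * 2 * exp (- 2 x) = 2 * exp (- eta) * exp (- x)]. *)
have Pbad : (P (\big[setU/set0]_(k < N) bad k) <= (2 * expR (- eta))%:E)%E.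
  apply: (le_trans (Boole_inequality P (fun k _ => mbad k))).
  apply: (@le_trans _ _ (\sum_(k < N) (2 * expR (- (2 * x)))%:E)%E).
    apply: lee_sum => k _; rewrite /bad valK; have [_ h _] := HA k; exact: h.
  rewrite sumEFin lee_fin sumr_const card_ord -[_ *+ N]mulr_natl.
  have -> : - (2 * x) = - x + - x by ring.
  rewrite expRD {1}eN.
  have -> : N%:R * (2 * (expR (- eta) / N%:R * expR (- x))) = 2 * expR (- eta) * expR (- x).
    by field; rewrite pnatr_eq0 -lt0n.
  rewrite ler_piMr ?mulr_ge0 ?expR_ge0// -[leRHS]expR0 ler_expR oppr_le0; exact: ltW.
exists (~` \big[setU/set0]_(k < N) bad k); split.
- by apply: measurableC; exact: bigsetU_measurable.
- rewrite probability_setC; last exact: bigsetU_measurable.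
  apply: (@le_trans _ _ (1 - (2 * expR (- eta))%:E)%E).
    rewrite -EFinB lee_fin lerB// ler_wpM2r ?expR_ge0//; lra.
  by apply: leeB.
move=> w /= Aw.
have {}Aw j : A j w.
  apply: contrapT => nAj; apply: Aw; rewrite -bigcup_mkord.
  by exists (nat_of_ord j) => /=; rewrite ?ltn_ord// /bad valK.
have G01 : 0 <= left_lim (Ghat Ti Ci w) tau <= 1 by exact: Ghat_left01.
have H0 : 0 <= Hhat Ti Ci tau w.
  by rewrite /Hhat /emp_at_risk mulr_ge0 ?invr_ge0// sumr_ge0.
have H1 : Hhat Ti Ci tau w <= 1.
  rewrite /Hhat /emp_at_risk mulrC ler_pdivrMr ?ltr0n// mul1r.
  apply: (@le_trans _ _ (\sum_(i < n) 1)); last by rewrite sumr_const card_ord.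
  by apply: ler_sum => i _; case: (tau <= _).
have [h0|h0] := eqVneq (Hhat Ti Ci tau w) 0.
  by apply: le_trans (rhs0 _); rewrite h0 !mul0r.
have {h0}H0 : 0 < Hhat Ti Ci tau w by rewrite lt_neqAle eq_sym h0.
have Ttau i : Ti i w <= tau by have [_ /andP[]] := sampleD i w.
have [j0 _] := cov _ Ffn.
have [_ _ /(_ _ (Aw j0))[nt _]] := HA j0.
pose t : R := 1 + 4 * Num.sqrt (2 * n%:R * x).
have close f : F f -> Hhat Ti Ci tau w * `|emp_risk Ti Ci Zi Yi L f w - risk P T Z Y L f|
    <= B * (t / n%:R) + 2 * (LM * eps).
  move=> Ff; have [j /sup_norm_leP fj] := cov _ Ff.
  have Lfj y t' z : 0 <= t' <= tau -> ZZ z ->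
      `|L y (f (t', z)) - L y (c j (t', z))| <= LM * eps.
    move=> ht hz; apply: le_trans (Llip _ _ (FMD _ Ff _ _ ht hz) (FMD _ (Fc j) _ _ ht hz) y) _.
    by rewrite ler_wpM2l//; exact: (fj _ (D1 _ _ ht hz)).
  have k0 : 0 <= LM * eps by rewrite mulr_ge0// ltW.
  have e1 : `|emp_risk Ti Ci Zi Yi L f w - emp_risk Ti Ci Zi Yi L (c j) w| <= LM * eps.
    apply: (emp_risk_lipschitz n0 Ttau nt H0 k0) => i.
    by have [_ ht hz] := sampleD i w; exact: Lfj.
  have bL g : F g -> bmeasurable (fun w => L (Y w) (g (T w, Z w))).
    move=> Fg; split.
      by apply: (measurable_loss mL (mF _ Fg)).
    by exists B => v; have /andP[h1 h2] := LB1 _ Fg (Y v) _ _ (T0tau v) (ZZZ v); rewrite ger0_norm.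
  have e2 : `|risk P T Z Y L f - risk P T Z Y L (c j)| <= LM * eps.
    rewrite /risk unlock -[fine _]/(\int[P]_w L (Y w) (f (T w, Z w))).
    rewrite -[X in _ - X]/(\int[P]_w L (Y w) (c j (T w, Z w))) -ExB; [|exact: bL..].
    apply: Ex_norm_le => [|v]; first by apply: bmeasurableB; exact: bL.
    exact: Lfj.
  have [_ _ /(_ _ (Aw j))[_ e3]] := HA j.
  apply: (@le_trans _ _ (Hhat Ti Ci tau w * `|emp_risk Ti Ci Zi Yi L (c j) w - risk P T Z Y L (c j)|
      + Hhat Ti Ci tau w * (2 * (LM * eps)))).
    rewrite -mulrDr ler_wpM2l//; first exact: ltW.
    move: e1 e2; move: (emp_risk _ _ _ _ _ f w) (emp_risk _ _ _ _ _ (c j) w).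
    move: (risk _ _ _ _ _ f) (risk _ _ _ _ _ (c j)) (LM * eps) => a b k a' b' e1 e2.
    have -> : a' - a = (b' - b) + ((a' - b') - (a - b)) by ring.
    apply: le_trans (ler_normD _ _) _; rewrite lerD2l.
    by apply: le_trans (ler_normB _ _) _; lra.
  by rewrite lerD// -[leRHS]mul1r ler_wpM2r// mulr_ge0.
have risk0 f : F f -> 0 <= risk P T Z Y L f.
  move=> Ff; rewrite /risk unlock.
  apply: (@Rintegral_ge0 _ _ _ P) => v _; exact: L0.
have [Ffw fnmin] := ermfn w.
have gap := erm_gap H0 Ffw risk0 fnmin close.
have /andP[G0 G1] := G01.
set gapw := `|_ - _| in gap *.
have gw0 : 0 <= gapw by exact: normr_ge0.
apply: (@le_trans _ _ (B^-1 * (2 * (B * (t / n%:R) + 2 * (LM * eps))))).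
  set G := left_lim _ tau in G0 G1 *; set h := Hhat _ _ _ _ in H0 gap *.
  have -> : h * G ^+ 2 / B * gapw = B^-1 * (h * gapw) * G ^+ 2.
    by field; rewrite gt_eqF.
  apply: (@le_trans _ _ (B^-1 * (h * gapw))).
    have G2 : G ^+ 2 <= 1 by exact: exprn_ile1.
    by rewrite ler_piMr// mulr_ge0 ?invr_ge0 ?(ltW B0)// mulr_ge0 ?(ltW H0).
  by rewrite ler_wpM2l// invr_ge0 ltW.
have -> : B^-1 * (2 * (B * (t / n%:R) + 2 * (LM * eps))) = 2 * t / n%:R + 4 * eps * LM / B.
  by field; rewrite pnatr_eq0 -lt0n n0 gt_eqF.
rewrite lerD2r /t.
have -> : 2 * eta + 2 * ln N%:R = 2 * x by rewrite /x; ring.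
have n1 : 1 <= Num.sqrt n%:R :> R by rewrite -[leLHS]sqrtr1 ler_wsqrtr// ler1n.
have nn : n%:R = Num.sqrt n%:R ^+ 2 :> R by rewrite sqr_sqrtr.
have -> : Num.sqrt (2 * n%:R * x) = Num.sqrt (2 * x) * Num.sqrt n%:R.
  by rewrite -sqrtrM ?mulr_ge0 ?(ltW x0)//; congr Num.sqrt; ring.
rewrite [X in _ / X <= _]nn; move: (Num.sqrt n%:R) n1 (Num.sqrt (2 * x)) => s s1 r.
have s0 : 0 < s by lra.
have -> : 2 * (1 + 4 * (r * s)) / s ^+ 2 = (2 / s + 8 * r) / s by field; rewrite gt_eqF.
rewrite ler_wpM2r ?invr_ge0 ?(ltW s0)// addrC lerD2l.
by rewrite ler_pdivrMr//; lra.
Qed.
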